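(* For $A\in\mathcal{A}_{n,1}$ let $A'=\Lambda^{-1}(\xi(\Lambda(A)))$. Then $A\mapsto A'$ is an involution of $\mathcal{A}_{n,1}$ and, for every $A\in\mathcal{A}_{n,1}$: (1) the opening row has the same index $k$ in $A$ and in $A'$, and rows $1$ to $k$ of $A$ and $A'$ coincide; in particular $r(A)=r(A')$; (2) $i(A')=i(A)$ and $J(A')=J(A)$; (3) $E(A')=B(A)$ and $B(A')=E(A)$; (4) $(\overline{A})'=\overline{A'}$.
   Context: An alternating sign matrix (ASM) of order $n$ is an $n\times n$ matrix $A=(a_{ij})$ with entries in $\{-1,0,1\}$ such that in every row and every column the nonzero entries alternate in sign, the first and the last nonzero entries being $1$. $\mathcal{A}_{n,s}$ denotes the set of order-$n$ ASMs having exactly $s$ entries equal to $-1$ (so $\mathcal{A}_{n,0}$ is the set of $n\times n$ permutation matrices). For an ASM $A=(a_{ij})$: $r(A)$ is the number of entries of the first row lying to the left of its unique nonzero entry (which is a $1$); $i(A)=\sum a_{ij}a_{k\ell}$, the sum over all pairs of positions with $k>i$ and $\ell<j$ (number of inversions); $\overline{A}=(a_{i,n+1-j})$ is the vertical reflection of $A$. Let $A\in\mathcal{A}_{n,1}$. The opening column is the column containing the unique $-1$; the closing row is the row containing the $-1$; the opening row is the row of the $1$ of the opening column lying above the $-1$. The columns strictly to the left (resp. right) of the opening column form the left side (resp. right side). The closing row contains exactly two $1$'s, one in each side; the one in the right side is the closing $1$ and its column is the closing column. The rows strictly between the opening row and the closing row are the enclosed rows. $A$ is neutral if there are no enclosed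 rows; otherwise $A$ is positive if the $1$ of the lowest enclosed row lies in the right side, and negative if it lies in the left side. $\mathcal{A}_{n,1}^{+},\mathcal{A}_{n,1}^{0},\mathcal{A}_{n,1}^{-}$ denote the sets of positive, neutral, negative elements of $\mathcal{A}_{n,1}$; $A$ is negative iff $\overline{A}$ is positive. For $A\in\mathcal{A}_{n,1}^{+}\cup\mathcal{A}_{n,1}^{0}$: the charged cell is the intersection of the enclosed rows with the right side; the extended neutral cell is the intersection of the rows from the opening row to the closing row (inclusive) with the left side. The leading $1$ is the highest $1$ in the left side strictly below the opening row; its column is the leading column; the leading cell consists of the entries strictly below the opening row and strictly between the leading column and the opening column, and $\ell(A)$ is the sum of its entries. The closing cell consists of the entries strictly below the closing row and strictly between the opening column and the closing column, and $c(A)$ is the sum of its entries; the extended closing cell consists of the entries strictly below the closing row in the columns from the opening column to the closing column inclusive. Parameters: if $A$ is positive, $E(A)$ is the sum of the entries of the charged cell; if $A$ is neutral, $E(A)=0$; if $A$ is negative, $E(A)=-E(\overline{A})$. For $A\in\mathcal{A}_{n,1}^{+}\cup\mathcal{A}_{n,1}^{0}$, $B(A)=c(A)-\ell(A)$ and $J(A)=c(A)+\ell(A)+|E(A)|+1$; for $A\in\mathcal{A}_{n,1}^{-}$, $B(A)=-B(\overline{A})$ and $J(A)=J(\overline{A})$. Horizontal displacement: for an $m\times q$ $(0,1)$-matrix $P$ whose nonzero columns are $j_1<\dots<j_t$ with $j_1=1$ and $j_t<q$, $H(P)$ is the $m\times q$ matrix whose column $j_{s+1}$ equals column $j_s$ of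 $P$ for $1\le s\le t$ (where $j_{t+1}=q$), all other columns being zero. Vertical displacement: for an $m\times q$ $(0,1)$-matrix $P$ whose nonzero rows are $i_1<\dots<i_t$ with $i_1>1$ and $i_t=m$, $V(P)$ is the $m\times q$ matrix whose row $i_{s-1}$ equals row $i_s$ of $P$ for $1\le s\le t$ (where $i_0=1$), all other rows being zero. Partial discharging procedure: for $A\in\mathcal{A}_{n,1}^{+}\cup\mathcal{A}_{n,1}^{0}$, $\delta(A)$ is obtained by applying successively the following steps (all cells, rows and columns referring to the positions they occupy in $A$): (1) replace the $-1$ and the closing $1$ by $0$; (2) replace the submatrix occupying the extended closing cell by its image under $H$; (3) replace the submatrix occupying the extended neutral cell by its image under $V$; (4) lower the entries of the extended neutral cell and of the charged cell by one row: in the left side, for each row $t$ strictly below the opening row up to and including the closing row, the left part of row $t$ becomes the former left part of row $t-1$, and the left part of the opening row becomes zero; in the right side, for each row $t$ from two rows below the opening row up to and including the closing row, the right part of row $t$ becomes the former right part of row $t-1$, and the right part of the row immediately below the opening row becomes zero. The complete discharging procedure is $\Delta(A)=(k,\delta(A),c(A),E(A))$, where $k$ is the index of the opening row of $A$. It is known that $\Delta$ is injective on $\mathcal{A}_{n,1}^{+}\cup\mathcal{A}_{n,1}^{0}$, and that whenever $\Delta(A)=(k,P,c,E)$, there is a unique $N\in\mathcal{A}_{n,1}^{+}\cup\mathcal{A}_{n,1}^{0}$ with $\Delta(N)=(k,P,c+E,0)$, and this $N$ is neutral. Neutralizing procedure $\Lambda$: for $A\in\mathcal{A}_{n,1}^{+}\cup\mathcal{A}_{n,1}^{0}$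 with $\Delta(A)=(k,P,c,E)$, $\Lambda(A)=(N,E)$ where $N$ is the unique element with $\Delta(N)=(k,P,c+E,0)$. For $A\in\mathcal{A}_{n,1}^{-}$, write $\Lambda(\overline{A})=(M,-E)$ and set $\Lambda(A)=(\overline{M},E)$. It is known that $\Lambda$ is a bijection from $\mathcal{A}_{n,1}$ onto $\mathcal{N}_{n,1}=\{(N,E)\,:\,N\in\mathcal{A}_{n,1}^{0},\ E\in\mathbb{Z},\ -\ell(N)\le E\le c(N)\}$. The map $\xi:\mathcal{N}_{n,1}\to\mathcal{N}_{n,1}$ is defined by $\xi(N,E)=(N,\,c(N)-\ell(N)-E)$. *)

(* Defs.v *)
(* Alternating sign matrices with exactly one -1 and the
   maps Delta, Lambda, xi of the paper.  All row/column indices are 0-based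
   internally (row 1 of the paper is row 0 here). *)
From HB Require Import structures.
From mathcomp Require Import all_boot all_order all_algebra.

Set Implicit Arguments.
Unset Strict Implicit.
Unset Printing Implicit Defensive.

Import Order.TTheory GRing.Theory Num.Theory.

Definition entry (n : nat) (A : 'M[int]_n) (i j : nat) : int :=
  match (insub i : option 'I_n), (insub j : option 'I_n) with
  | Some i', Some j' => A i' j'
  | _, _ => 0%R
  end.

(* "the" i < n satisfying P (used only where such an i is unique) *)
Definition the_nat (n : nat) (P : pred nat) : nat :=
  nth 0 [seq i <- iota 0 n | P i] 0.

Definition alt_ok (s : seq int) : bool :=
  let t := [seq x <- s | x != 0%R] in
  [&& all (fun x => x \in [:: (-1)%R; 0%R; 1%R]) s,
      t != [::], head 0%R t == 1%R, last 0%R t == 1%R &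
      path (fun x y => y == (- x)%R) (head 0%R t) (behead t)].

Definition is_asm (n : nat) (A : 'M[int]_n) : bool :=
  [forall i : 'I_n, alt_ok [seq A i j | j <- enum 'I_n]] &&
  [forall j : 'I_n, alt_ok [seq A i j | i <- enum 'I_n]].

Definition nminus (n : nat) (A : 'M[int]_n) : nat :=
  #|[set ij : 'I_n * 'I_n | A ij.1 ij.2 == (-1)%R]|.

Definition inAns (n s : nat) (A : 'M[int]_n) : bool := is_asm A && (nminus A == s).
Definition inA1 (n : nat) (A : 'M[int]_n) : bool := inAns 1 A.

Definition asm_bar (n : nat) (A : 'M[int]_n) : 'M[int]_n :=
  \matrix_(i, j) A i (rev_ord j).

(* r(A) : number of entries of the first row left of its nonzero entry *)
Definition rnum (n : nat) (A : 'M[int]_n) : nat :=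
  the_nat n (fun j => entry A 0 j != 0%R).

Definition ninv (n : nat) (A : 'M[int]_n) : int :=
  (\sum_(i < n) \sum_(j < n) \sum_(k < n | (i < k)%N) \sum_(l < n | (l < j)%N)
      A i j * A k l)%R.

Section OneMinus.
Variable n : nat.
Implicit Types A : 'M[int]_n.

Definition crow A : nat :=
  the_nat n (fun i => has (fun j => entry A i j == (-1)%R) (iota 0 n)).
Definition ocol A : nat :=
  the_nat n (fun j => has (fun i => entry A i j == (-1)%R) (iota 0 n)).
Definition orow A : nat :=
  the_nat n (fun i => (i < crow A) && (entry A i (ocol A) == 1%R)).
Definition ccol A : nat :=
  the_nat n (fun j => (ocol A < j) && (entry A (crow A) j == 1%R)).
(* column of the 1 of row i (for rows with a single nonzero entry) *)
Definition one_col A (i : nat) : nat :=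
  the_nat n (fun j => entry A i j == 1%R).

Definition neutral A : bool := (orow A).+1 == crow A.
Definition positive A : bool :=
  ((orow A).+1 < crow A) && (ocol A < one_col A (crow A).-1).
Definition negative A : bool :=
  ((orow A).+1 < crow A) && (one_col A (crow A).-1 < ocol A).

Definition charged_sum A : int :=
  (\sum_((orow A).+1 <= i < crow A) \sum_((ocol A).+1 <= j < n) entry A i j)%R.

Definition lead_row A : nat :=
  (orow A).+1 +
  find (fun i => has (fun j => (j < ocol A) && (entry A i j == 1%R)) (iota 0 n))
       (iota (orow A).+1 (n - (orow A).+1)).
Definition lead_col A : nat :=
  the_nat n (fun j => (j < ocol A) && (entry A (lead_row A) j == 1%R)).

Definition ell A : int :=
  (\sum_((orow A).+1 <= i < n) \sum_((lead_col A).+1 <= j < ocol A) entry A i j)%R.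
Definition cval A : int :=
  (\sum_((crow A).+1 <= i < n) \sum_((ocol A).+1 <= j < ccol A) entry A i j)%R.

(* parameters on positive/neutral elements *)
Definition Epn A : int := if positive A then charged_sum A else 0%R.
Definition Bpn A : int := (cval A - ell A)%R.
Definition Jpn A : int := (cval A + ell A + `|Epn A| + 1)%R.

Definition dstep1 A : nat -> nat -> int := fun i j =>
  if (i == crow A) && ((j == ocol A) || (j == ccol A)) then 0%R else entry A i j.

(* horizontal displacement H on the extended closing cell *)
Definition dstep2 A : nat -> nat -> int :=
  let M1 := dstep1 A in
  let p := crow A in let q := ocol A in let c := ccol A in
  let js := [seq j <- iota q (c - q).+1 |
              has (fun i => M1 i j != 0%R) (iota p.+1 (n - p.+1))] in
  let js' := rcons (behead js) c in
  fun i j =>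
    if (p < i) && (q <= j <= c) then
      (let k := index j js' in if k < size js' then M1 i (nth 0 js k) else 0%R)
    else M1 i j.

(* vertical displacement V on the extended neutral cell *)
Definition dstep3 A : nat -> nat -> int :=
  let M2 := dstep2 A in
  let p := crow A in let q := ocol A in let o := orow A in
  let is_ := [seq i <- iota o (p - o).+1 | has (fun j => M2 i j != 0%R) (iota 0 q)] in
  let is' := o :: take (size is_).-1 is_ in
  fun i j =>
    if (o <= i <= p) && (j < q) then
      (let k := index i is' in if k < size is' then M2 (nth 0 is_ k) j else 0%R)
    else M2 i j.

(* lowering the extended neutral cell and the charged cell by one row *)
Definition dstep4 A : nat -> nat -> int :=
  let M3 := dstep3 A in
  let p := crow A in let q := ocol A in let o := orow A in
  fun i j =>
    if (j < q) && (o <= i <= p) then (if i == o then 0%R else M3 i.-1 j)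
    else if (q < j) && (o < i <= p) then (if i == o.+1 then 0%R else M3 i.-1 j)
    else M3 i j.

Definition delta A : 'M[int]_n := \matrix_(i, j) dstep4 A i j.

(* complete discharging procedure Delta (k is the 0-based opening row) *)
Definition Delta A : nat * 'M[int]_n * int * int := (orow A, delta A, cval A, Epn A).

(* matrices with entries in {-1,0,1}, enumerated by a finite type *)
Definition asm_of_code (f : {ffun 'I_n * 'I_n -> 'I_3}) : 'M[int]_n :=
  \matrix_(i, j) ((nat_of_ord (f (i, j)))%:Z - 1)%R.

(* the unique N in A^+ u A^0 with Delta(N) = (k, P, c + E, 0) *)
Definition neutral_partner A : 'M[int]_n :=
  match [pick f : {ffun 'I_n * 'I_n -> 'I_3} |
          [&& inA1 (asm_of_code f), positive (asm_of_code f) || neutral (asm_of_code f) &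
              Delta (asm_of_code f) == (orow A, delta A, (cval A + Epn A)%R, 0%R)]]
  with Some f => asm_of_code f | None => A end.

Definition LambdaPN A : 'M[int]_n * int := (neutral_partner A, Epn A).

Definition Lambda A : 'M[int]_n * int :=
  if negative A then (asm_bar (LambdaPN (asm_bar A)).1, (- (LambdaPN (asm_bar A)).2)%R)
  else LambdaPN A.

Definition xi (NE : 'M[int]_n * int) : 'M[int]_n * int :=
  (NE.1, (cval NE.1 - ell NE.1 - NE.2)%R).

(* inverse of Lambda : N_{n,1} -> A_{n,1} (the unique preimage in A_{n,1}) *)
Definition Lambda_inv (NE : 'M[int]_n * int) : 'M[int]_n :=
  match [pick f : {ffun 'I_n * 'I_n -> 'I_3} |
          inA1 (asm_of_code f) && (Lambda (asm_of_code f) == NE)]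
  with Some f => asm_of_code f | None => 0%R end.

Definition Eprm A : int := if negative A then (- Epn (asm_bar A))%R else Epn A.
Definition Bprm A : int := if negative A then (- Bpn (asm_bar A))%R else Bpn A.
Definition Jprm A : int := if negative A then Jpn (asm_bar A) else Jpn A.

Definition asm_prime A : 'M[int]_n := Lambda_inv (xi (Lambda A)).

End OneMinus.

(* Main.v *)
(** An alternating sign matrix with one -1 is a map [s] from rows to columns
    together with the closing 1: row [i] carries a 1 in column [s i], and the
    closing row [p] carries in addition -1 in the opening column [q] and 1 in
    the closing column [c].  Discharging turns [s] into a permutation [f]: the
    displacements H and V slide contents along a list of marked positions to the
    next or previous mark, and the marks can be read off either from [s] or from
    [f], so [s] and [f] determine each other once [o], [p], [c] are known.  For
    non-negative matrices, E = #{o < i <= p : q < f i} and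
    c(A) + 1 = #{i > p : q < f i <= c}, so E determines [p] and then c(A)
    determines [c].  Hence Delta is a bijection onto the (o, f, c, E) with
    f (o+1) < f o and c + E < #{i > o : f o < f i}, a condition that depends on
    c + E only; the number l(A) depends on (o, f) only, and
    i(A) = i(f) + c(A) + E + 1.  So N keeps the inversion number and the rows
    down to [o], with c(N) = c(A) + E and l(N) = l(A).  Reflection swaps c and l
    on neutral matrices and sends i to a constant minus i, which settles the
    negative case and the symmetry statement. *)
Require Import Defs.
From mathcomp Require Import all_boot all_order all_algebra.
From mathcomp Require Import zify.

Set Implicit Arguments.
Unset Strict Implicit.
Unset Printing Implicit Defensive.

Import Order.TTheory GRing.Theory Num.Theory.

Local Notation "n %:Z" := (Posz n) : nat_scope.

(** * Marked positions *)

(* [next_mark D hi x] is [hi] when no mark lies strictly between [x] and [hi];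
   symmetrically [prev_mark D lo y] defaults to [lo]. *)
Definition next_mark (D : pred nat) (hi x : nat) : nat :=
  x.+1 + find D (iota x.+1 (hi - x.+1)).

Fixpoint prev_mark (D : pred nat) (lo y : nat) : nat :=
  if y is y'.+1 then if (y' <= lo) || D y' then y' else prev_mark D lo y' else 0.

Implicit Type D : pred nat.

Lemma next_markP D hi x : x < hi ->
  [/\ x < next_mark D hi x <= hi, (next_mark D hi x == hi) || D (next_mark D hi x)
    & forall y, x < y < next_mark D hi x -> D y = false].
Proof.
move=> ltx; rewrite /next_mark; set f := find _ _.
have szf : f <= hi - x.+1 by rewrite -[X in _ <= X](size_iota x.+1) find_size.
split; first by lia.
- have [hf|hf] := ltnP f (hi - x.+1); last by apply/orP; left; lia.
  apply/orP; right; rewrite -(nth_iota 0 _ hf) /f nth_find //.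
  by rewrite has_find size_iota.
- move=> y /andP[xy yf].
  have hy : y - x.+1 < f by lia.
  have := before_find 0 hy; rewrite nth_iota; last by lia.
  by rewrite subnKC.
Qed.

Lemma prev_markP D lo y : lo < y ->
  [/\ lo <= prev_mark D lo y < y, (prev_mark D lo y == lo) || D (prev_mark D lo y)
    & forall z, prev_mark D lo y < z < y -> D z = false].
Proof.
elim: y => // y IH ly /=; case: ifPn => [h|].
  split; [by lia| |by move=> z; lia].
  by case/orP: h => [h|->]; rewrite ?orbT //; apply/orP; left; lia.
rewrite negb_or -ltnNge => /andP[h1 h2]; have [h3 h4 h5] := IH h1.
split=> //; first by lia.
move=> z zy; have [->|nzy] := eqVneq z y; first exact: negbTE.
by apply: h5; lia.
Qed.

Lemma next_mark_unique D hi x y : x < y <= hi -> (y == hi) || D y ->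
  (forall z, x < z < y -> D z = false) -> next_mark D hi x = y.
Proof.
move=> xy Dy nD; have [|h1 h2 h3] := @next_markP D hi x; first by lia.
have [lt|lt|//] := ltngtP (next_mark D hi x) y.
- by case/orP: h2 => [|h2]; [lia|rewrite nD // in h2; lia].
- by case/orP: Dy => [|Dy]; [lia|rewrite h3 // in Dy; lia].
Qed.

Lemma prev_mark_unique D lo x y : lo <= x < y -> (x == lo) || D x ->
  (forall z, x < z < y -> D z = false) -> prev_mark D lo y = x.
Proof.
move=> xy Dy nD; have [|h1 h2 h3] := @prev_markP D lo y; first by lia.
have [lt|lt|//] := ltngtP (prev_mark D lo y) x.
- by case/orP: Dy => [|Dy]; [lia|rewrite h3 // in Dy; lia].
- by case/orP: h2 => [|h2]; [lia|rewrite nD // in h2; lia].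
Qed.

Lemma prev_markK D lo hi y : lo < y <= hi -> (y == hi) || D y ->
  next_mark D hi (prev_mark D lo y) = y.
Proof.
move=> ly Dy; have [|h1 h2 h3] := @prev_markP D lo y; first by lia.
by apply: next_mark_unique => //; lia.
Qed.

Lemma next_markK D lo hi x : lo <= x < hi -> (x == lo) || D x ->
  prev_mark D lo (next_mark D hi x) = x.
Proof.
move=> lx Dx; have [|h1 h2 h3] := @next_markP D hi x; first by lia.
by apply: prev_mark_unique => //; lia.
Qed.

Lemma eq_next_mark (D D' : pred nat) hi x : x < hi -> (forall y, x < y < hi -> D y = D' y) ->
  next_mark D hi x = next_mark D' hi x.
Proof.
move=> xh eD; have [h1 h2 h3] := @next_markP D' hi x xh.
apply: next_mark_unique => //.
  have [//|ne] := eqVneq (next_mark D' hi x) hi; rewrite eD; last by lia.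
  by rewrite (negbTE ne) in h2.
by move=> z zz; rewrite eD ?h3 //; lia.
Qed.

Lemma eq_prev_mark (D D' : pred nat) lo y : lo < y -> (forall z, lo < z < y -> D z = D' z) ->
  prev_mark D lo y = prev_mark D' lo y.
Proof.
move=> xh eD; have [h1 h2 h3] := @prev_markP D' lo y xh.
apply: prev_mark_unique => //.
  have [//|ne] := eqVneq (prev_mark D' lo y) lo; rewrite eD; last by lia.
  by rewrite (negbTE ne) in h2.
by move=> z zz; rewrite eD ?h3 //; lia.
Qed.

(** A search from [x] cannot run past the mark [y], while a search from [y] ends strictly beyond it.
    This is why H preserves the order of the contents. *)
Lemma next_mark_mono D hi x y : x < y < hi -> D y -> next_mark D hi x < next_mark D hi y.
Proof.
move=> xy Dy; have [|h1 h2 h3] := @next_markP D hi x; first by lia.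
have [|g1 g2 g3] := @next_markP D hi y; first by lia.
have : ~~ (y < next_mark D hi x) by apply/negP => lt; rewrite h3 // in Dy; lia.
lia.
Qed.

(* The displacement V followed by the lowering step sends the content of row [i]
   to row [rout i], for [o < i <= p]; [rin] is the inverse. *)
Definition rin (D : pred nat) o p i :=
  if (i == o.+1) || D i.-1 then next_mark D p i.-1 else i.-1.
Definition rout (D : pred nat) o p i :=
  if (i == p) || D i then (prev_mark D o i).+1 else i.+1.

Lemma rin_bounds D o p i : o < i <= p -> o < rin D o p i <= p.
Proof.
move=> oi; rewrite /rin; case: ifP => h; last by lia.
have [|h1 h2 h3] := @next_markP D p i.-1; lia.
Qed.

Lemma rout_bounds D o p i : o < i <= p -> o < rout D o p i <= p.
Proof.
move=> oi; rewrite /rout; case: ifP => h; last by lia.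
have [|h1 h2 h3] := @prev_markP D o i; lia.
Qed.

Lemma routK D o p i : o < i <= p -> rin D o p (rout D o p i) = i.
Proof.
move=> oi; rewrite /rout; case: ifP => h; rewrite /rin.
  have [|h1 h2 h3] := @prev_markP D o i; first by lia.
  by rewrite eqSS -pred_Sn h2 (@prev_markK D o p).
by case/norP: (negbT h) => _ /negbTE hD; rewrite -pred_Sn hD ifF //; lia.
Qed.

Lemma rinK D o p i : o < i <= p -> rout D o p (rin D o p i) = i.
Proof.
move=> oi; rewrite /rin; case: ifP => h; rewrite /rout.
  have [|h1 h2 h3] := @next_markP D p i.-1; first by lia.
  rewrite h2 next_markK ?prednK //; try lia.
by case/norP: (negbT h) => ? /negbTE hD; rewrite hD ifF //; lia.
Qed.

(* The displacement H sends the content of column [v] to column [cright v]; [cleft]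
   is the inverse. *)
Definition cright (D : pred nat) q c v := if q <= v < c then next_mark D c v else v.
Definition cleft (D : pred nat) q c v := if q < v <= c then prev_mark D q v else v.

Lemma crightK D q c v : v != c -> (q < v < c -> D v) ->
  cleft D q c (cright D q c v) = v.
Proof.
move=> nvc Dv; rewrite /cright; case: ifP => h.
  have [|h1 h2 h3] := @next_markP D c v; first by lia.
  rewrite /cleft ifT ?next_markK //; try lia.
by rewrite /cleft ifF //; lia.
Qed.

Lemma cleftK D q c v : v != q -> (q < v < c -> D v) ->
  cright D q c (cleft D q c v) = v.
Proof.
move=> nvc Dv; rewrite /cleft; case: ifP => h.
  have [|h1 h2 h3] := @prev_markP D q v; first by lia.
  rewrite /cright ifT ?prev_markK //; try lia.
by rewrite /cright ifF //; lia.
Qed.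

Lemma cright_mono D q c v w : (q < v < c -> D v) -> (q < w < c -> D w) ->
  v != c -> w != c -> v < w -> cright D q c v < cright D q c w.
Proof.
move=> Dv Dw nv nw vw; rewrite /cright.
case: ifP => hv; case: ifP => hw //; try by lia.
- by apply: next_mark_mono; [lia|apply: Dw; lia].
- by have [|h1 h2 h3] := @next_markP D c v; lia.
- by have [|h1 h2 h3] := @next_markP D c w; lia.
Qed.

(** * Row functions *)

Section Shapes.
Variable n : nat.
Implicit Types (s f : nat -> nat) (o p b c : nat).

(* [o], [p], [c] are the opening row, closing row and closing column, [s o] is the
   opening column and [b] the row of its second 1; [s p] is the left 1 of row [p]. *)
Record shape s o p b c : Prop := Shape {
  sh_op : o < p; sh_pb : p < b; sh_bn : b < n; sh_cn : c < n;
  sh_lt : forall i, i < n -> s i < n;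
  sh_b : s b = s o; sh_a : s p < s o; sh_q : s o < c;
  sh_inj : forall i k, i < k -> k < n -> s i = s k -> i = o /\ k = b;
  sh_c : forall i, i < n -> s i <> c }.

(** The data left after discharging. [ps_a] reflects that the leading 1 lands in row [o+1], and
    [ps_c] that H moves some 1 below row [p] into the closing column. *)
Record pshape f o p c : Prop := PShape {
  ps_op : o < p; ps_pn : p < n;
  ps_lt : forall i, i < n -> f i < n;
  ps_a : f o.+1 < f o; ps_q : f o < c;
  ps_inj : forall i k, i < n -> k < n -> f i = f k -> i = k;
  ps_c : exists k, p < k < n /\ f k = c }.

Definition colmark f p : pred nat :=
  fun j => has (fun i => f i == j) (index_iota p.+1 n).

(** The middle rows are described by where their content comes from, hence [rin]; the bottom rows
    keep their content and only change columns. *)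
Definition fwd s o p c i :=
  if i <= o then s i
  else if i <= p then s (rin (fun x => s x < s o) o p i)
  else cright (colmark s p) (s o) c (s i).

Definition back f o p c i :=
  if i <= o then f i
  else if i <= p then f (rout (fun x => f x.+1 < f o) o p i)
  else cleft (colmark f p) (f o) c (f i).

Lemma colmarkP f p j : reflect (exists i, p < i < n /\ f i = j) (colmark f p j).
Proof.
apply: (iffP hasP) => [[i]|[i [hi fi]]].
  by rewrite mem_index_iota => hi /eqP fi; exists i.
by exists i; rewrite ?mem_index_iota //; apply/eqP.
Qed.

(** * From a row function to its discharged permutation *)

Section Fwd.
Variables (s : nat -> nat) (o p b c : nat).
Hypothesis S : shape s o p b c.
Let q := s o.
Let Dr x := s x < s o.
Let Dc := colmark s p.
Let f := fwd s o p c.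

Let op := sh_op S. Let pb := sh_pb S. Let bn := sh_bn S. Let cn := sh_cn S.
Let sb := sh_b S. Let sa := sh_a S. Let qc := sh_q S.

Lemma fwd_top i : i <= o -> f i = s i.
Proof. by rewrite /f /fwd => ->. Qed.

Lemma fwd_mid i : o < i <= p -> f i = s (rin Dr o p i).
Proof. by move=> h; rewrite /f /fwd ifF ?ifT //; lia. Qed.

Lemma fwd_bot i : p < i -> f i = cright Dc q c (s i).
Proof. by move=> h; rewrite /f /fwd !ifF //; lia. Qed.

Lemma sh_eq_o i : i < n -> s i = q -> i = o \/ i = b.
Proof.
move=> hi e; have [h|h|->] := ltngtP i o; last by left.
- have := sh_inj S h; rewrite e => h'; have := h' _ erefl; lia.
- by have := sh_inj S h hi (esym e); right; lia.
Qed.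

(** V moves left contents among marked rows only, and lowering shifts by one row. So the side of the
    old row [i] is visible in the new row [i+1], which is the test that [back] uses. *)
Lemma fwd_left i : o < i < p -> (f i.+1 < q) = (s i < q).
Proof.
move=> h; rewrite fwd_mid; last by lia.
rewrite /rin eqSS -pred_Sn; case: ifPn => [|]; last by rewrite negb_or => /andP[].
case/orP; first by lia.
move=> hD; have [|h1 h2 h3] := @next_markP Dr p i; first by lia.
have : s i < q by [].
by move=> ->; case/orP: h2 => [/eqP ->|].
Qed.

(** A moved value lands on the default [c] or on a later mark, and an unmoved one is not [q].
    Excluding [q] prevents a clash with row [o] in the injectivity proof. *)
Lemma cright_range k : p < k < n ->
  (cright Dc q c (s k) = c) \/
  exists k', [/\ p < k' < n, s k' = cright Dc q c (s k) & s k' <> q].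
Proof.
move=> hk; rewrite /cright; case: ifP => h.
  have [|h1 h2 h3] := @next_markP Dc c (s k); first by lia.
  have [->|ne] := eqVneq (next_mark Dc c (s k)) c; first by left.
  right; rewrite (negbTE ne) /= in h2; case/colmarkP: h2 => k' [hk' e].
  by exists k'; split => //; rewrite e; lia.
right; exists k; split => // e; lia.
Qed.

Lemma colmark_row k : p < k < n -> Dc (s k).
Proof. by move=> hk; apply/colmarkP; exists k. Qed.

(** A mark between [q] and [c] is refilled from the mark before it, or from row [b], which stands in
    column [q], if there is none. H thus leaves the set of inner marks unchanged. *)
Lemma fwd_mark j : q < j < c -> colmark f p j = Dc j.
Proof.
move=> hj; apply/idP/idP => /colmarkP [k [hk e]].
  rewrite fwd_bot in e; last by lia.
  case: (cright_range hk) => [|[k' [hk' e' _]]]; first by lia.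
  by apply/colmarkP; exists k'; split => //; lia.
have [|h1 h2 h3] := @prev_markP Dc q j; first by lia.
set x := prev_mark Dc q j in h1 h2 h3.
have [k' [hk' ek']] : exists k', p < k' < n /\ s k' = x.
  case/orP: h2 => [/eqP ->|/colmarkP //].
  by exists b; split; [lia|rewrite sb].
apply/colmarkP; exists k'; split => //; rewrite fwd_bot; last by lia.
rewrite ek' /cright ifT; last by lia.
apply: next_mark_unique => //; first by lia.
by rewrite -e colmark_row ?orbT.
Qed.

Lemma fwd_c : exists k, p < k < n /\ f k = c.
Proof.
have [|h1 h2 h3] := @prev_markP Dc q c; first by lia.
set x := prev_mark Dc q c in h1 h2 h3.
have [k' [hk' ek']] : exists k', p < k' < n /\ s k' = x.
  case/orP: h2 => [/eqP ->|/colmarkP //].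
  by exists b; split; [lia|rewrite sb].
exists k'; split => //; rewrite fwd_bot; last by lia.
rewrite ek' /cright ifT; last by lia.
by apply: next_mark_unique => //; [lia|rewrite eqxx].
Qed.

Lemma fwd_mono i k : p < i < n -> p < k < n -> s i < s k -> f i < f k.
Proof.
move=> hi hk h; rewrite !fwd_bot; try lia.
have ci := sh_c S (i := i); have ck := sh_c S (i := k).
by apply: cright_mono => //; try lia; move=> _; apply: colmark_row.
Qed.

Lemma fwd_inj_lt i k : i < k -> k < n -> f i <> f k.
Proof.
move=> ik kn.
(* Rows down to [p] take their content from rows down to [p], so a clash of [f] there comes back to
   one of [s]. *)
have top_s x : x <= p -> exists2 y, y <= p & s y = f x.
  move=> xp; have [xo|xo] := leqP x o; first by exists x; rewrite ?fwd_top.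
  rewrite fwd_mid; last by lia.
  have := @rin_bounds Dr o p x; exists (rin Dr o p x) => //; lia.
have [hip|hip] := leqP i p; last first.
  have ne : s i <> s k by move=> e; have := sh_inj S ik kn e; lia.
  have [h|h|//] := ltngtP (s i) (s k).
    by have := @fwd_mono i k; lia.
  by have := @fwd_mono k i; lia.
have [hkp|hkp] := leqP k p; last first.
  (* A value from below [p] is [c], which [s] avoids, or a value of [s] other than [q]; but the only
     coincidence of [s] is at [q]. *)
  have [y hy <-] := top_s i hip; rewrite fwd_bot //.
  have [|->|[k' [hk' <- nq]] e] := @cright_range k; first by lia.
    by have := sh_c S (i := y); lia.
  have [||//|yo _] := @sh_inj _ _ _ _ _ S y k'; try lia.
  by apply: nq; rewrite -e yo.
have [hio|hio] := leqP i o.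
  rewrite fwd_top //; have [hko|hko] := leqP k o.
    rewrite fwd_top // => e; have := sh_inj S ik kn e; lia.
  rewrite fwd_mid; last by lia.
  have := @rin_bounds Dr o p k => h e.
  have := @sh_inj _ _ _ _ _ S i (rin Dr o p k); lia.
rewrite !fwd_mid; try lia.
move=> e; have h1 := @rin_bounds Dr o p k; have h2 := @rin_bounds Dr o p i.
have e2 : rin Dr o p i = rin Dr o p k.
  have := @sh_inj _ _ _ _ _ S (rin Dr o p i) (rin Dr o p k).
  have := @sh_inj _ _ _ _ _ S (rin Dr o p k) (rin Dr o p i).
  by have [] := ltngtP (rin Dr o p i) (rin Dr o p k); lia.
have := congr1 (rout Dr o p) e2; rewrite !rinK; lia.
Qed.

Lemma fwd_pshape : pshape f o p c.
Proof.
split => //; try lia.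
- move=> i hi; have [hio|hio] := leqP i o; first by rewrite fwd_top // (sh_lt S).
  have [hip|hip] := leqP i p.
    rewrite fwd_mid ?(sh_lt S) //; last by lia.
    by have := @rin_bounds Dr o p i; lia.
  rewrite fwd_bot //; have [|->//|[k [hk <- _]]] := @cright_range i; first by lia.
  by apply: (sh_lt S); lia.
- rewrite fwd_mid; last by lia.
  rewrite fwd_top // /rin eqxx /= .
  have [|h1 h2 h3] := @next_markP Dr p o; first by lia.
  by case/orP: h2 => [/eqP ->|].
- by rewrite fwd_top.
- move=> i k hi hk e; have := @fwd_inj_lt i k; have := @fwd_inj_lt k i; lia.
- exact: fwd_c.
Qed.

Lemma fwdK i : i < n -> back f o p c i = s i.
Proof.
move=> hi; rewrite /back; case: leqP => [hio|hio]; first exact: fwd_top.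
have fo : f o = s o by rewrite fwd_top.
case: leqP => hip.
  have -> : rout (fun x => f x.+1 < f o) o p i = rout Dr o p i.
    (* [rout] treats row [p] as marked whatever [f p.+1] is; for [i = p] only the marks strictly
       above matter, and [fwd_left] controls these. *)
    rewrite /rout fo; have [e|ne] := eqVneq i p.
      by congr _.+1; apply: eq_prev_mark => // z hz; rewrite fwd_left //; lia.
    rewrite fwd_left; last by lia.
    rewrite /Dr; case: ifP => //= _; congr _.+1; apply: eq_prev_mark => // z hz.
    by rewrite fwd_left //; lia.
  rewrite fwd_mid; last by apply: rout_bounds; lia.
  by rewrite routK //; lia.
rewrite fo fwd_bot //.
have -> : cleft (colmark f p) (s o) c (cright Dc q c (s i)) =
          cleft Dc q c (cright Dc q c (s i)).
  rewrite /cleft -/q; case: ifP => // h; apply: eq_prev_mark; first by lia.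
  by move=> z hz; apply: fwd_mark; lia.
rewrite crightK //; first by apply/eqP; apply: sh_c S _ hi.
by move=> _; apply: colmark_row; lia.
Qed.

End Fwd.

(** * From a permutation back to a row function *)

Section Back.
Variables (f : nat -> nat) (o p c : nat).
Hypothesis P : pshape f o p c.
Let q := f o.
Let Dr x := f x.+1 < f o.
Let Dc := colmark f p.
Let s := back f o p c.

Let op := ps_op P. Let pn := ps_pn P.
Let fa := ps_a P. Let qc := ps_q P.

Lemma back_top i : i <= o -> s i = f i.
Proof. by rewrite /s /back => ->. Qed.

Lemma back_mid i : o < i <= p -> s i = f (rout Dr o p i).
Proof. by move=> h; rewrite /s /back ifF ?ifT //; lia. Qed.

Lemma back_bot i : p < i -> s i = cleft Dc q c (f i).
Proof. by move=> h; rewrite /s /back !ifF //; lia. Qed.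

Lemma f_neq_o k : o < k < n -> f k <> q.
Proof. by move=> h e; have := @ps_inj _ _ _ _ P o k; lia. Qed.

Lemma back_left i : o < i < p -> (s i < q) = (f i.+1 < q).
Proof.
move=> h; rewrite back_mid; last by lia.
rewrite /rout; case: ifPn => [|]; last by rewrite negb_or => /andP[].
case/orP; first by lia.
move=> hD; have [|h1 h2 h3] := @prev_markP Dr o i; first by lia.
have : f i.+1 < q by [].
by move=> ->; case/orP: h2 => [/eqP ->|].
Qed.

Lemma cleft_range k : p < k < n ->
  (cleft Dc q c (f k) = q) \/
  exists k', [/\ p < k' < n, f k' = cleft Dc q c (f k) & f k' <> c].
Proof.
move=> hk; rewrite /cleft; case: ifP => h.
  have [|h1 h2 h3] := @prev_markP Dc q (f k); first by lia.
  have [->|ne] := eqVneq (prev_mark Dc q (f k)) q; first by left.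
  right; rewrite (negbTE ne) /= in h2; case/colmarkP: h2 => k' [hk' e].
  by exists k'; split => //; rewrite e; lia.
right; exists k; split => // e; lia.
Qed.

Lemma back_mark j : q < j < c -> colmark s p j = Dc j.
Proof.
move=> hj; apply/idP/idP => /colmarkP [k [hk e]].
  rewrite back_bot in e; last by lia.
  case: (cleft_range hk) => [|[k' [hk' e' _]]]; first by lia.
  by apply/colmarkP; exists k'; split => //; lia.
have [|h1 h2 h3] := @next_markP Dc c j; first by lia.
set x := next_mark Dc c j in h1 h2 h3.
have [k' [hk' ek']] : exists k', p < k' < n /\ f k' = x.
  by case/orP: h2 => [/eqP ->|/colmarkP //]; apply: ps_c P.
apply/colmarkP; exists k'; split => //; rewrite back_bot; last by lia.
rewrite ek' /cleft ifT; last by lia.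
apply: prev_mark_unique => //; first by lia.
by rewrite -e /Dc colmark_row ?orbT.
Qed.

Lemma backK i : i < n -> fwd s o p c i = f i.
Proof.
move=> hi; rewrite /fwd; case: leqP => [hio|hio]; first exact: back_top.
have so : s o = f o by rewrite back_top.
case: leqP => hip.
  have -> : rin (fun x => s x < s o) o p i = rin Dr o p i.
    rewrite /rin so; have [e|ne] := eqVneq i o.+1.
      by apply: eq_next_mark; [lia|move=> y hy; rewrite back_left //; lia].
    rewrite back_left; last by lia.
    rewrite /Dr; case: ifP => //= _; apply: eq_next_mark => [|z hz]; first by lia.
    by rewrite back_left //; lia.
  rewrite back_mid; last by apply: rin_bounds; lia.
  by rewrite rinK //; lia.
rewrite so back_bot //.
have -> : cright (colmark s p) (f o) c (cleft Dc q c (f i)) =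
          cright Dc q c (cleft Dc q c (f i)).
  rewrite /cright -/q; case: ifP => // h; apply: eq_next_mark; first by lia.
  by move=> z hz; apply: back_mark; lia.
rewrite cleftK //; first by apply/eqP; apply: f_neq_o; lia.
by move=> _; apply: colmark_row; lia.
Qed.

Lemma back_shape : exists b, shape s o p b c.
Proof.
have [kc [hkc ekc]] := ps_c P.
have cn : c < n by rewrite -ekc; apply: (ps_lt P); lia.
have so : s o = q by rewrite back_top.
(* H slid the second 1 of column [q] to the first mark after [q], or to [c] if there is none; [b] is
   the row that [f] sends there. *)
have [|h1 h2 h3] := @next_markP Dc c q; first by lia.
set x := next_mark Dc c q in h1 h2 h3.
have [b [hb eb]] : exists b, p < b < n /\ f b = x.
  by case/orP: h2 => [/eqP ->|/colmarkP //]; exists kc.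
have sb : s b = q.
  rewrite back_bot ?eb /cleft ?ifT; try lia.
  by rewrite next_markK //; [lia|rewrite eqxx].
have top_f y : y <= p -> exists2 z, z <= p & f z = s y.
  move=> xp; have [xo|xo] := leqP y o; first by exists y; rewrite ?back_top.
  rewrite back_mid; last by lia.
  have := @rout_bounds Dr o p y; exists (rout Dr o p y) => //; lia.
have bot_inj i k : p < i < n -> p < k < n -> s i = s k -> i = k.
  move=> hi hk; rewrite !back_bot; try lia.
  move/(congr1 (cright Dc q c)); rewrite !cleftK; try (by move=> _; apply: colmark_row).
  - by move=> e; have := @ps_inj _ _ _ _ P i k; lia.
  - by apply/eqP; apply: f_neq_o; lia.
  - by apply/eqP; apply: f_neq_o; lia.
have s_neq_q i : o < i -> i < n -> i <> b -> s i <> q.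
  move=> oi hi ib; have [hip|hip] := leqP i p; last first.
    by rewrite -sb => e; apply: ib; apply: bot_inj; lia.
  rewrite back_mid; last by lia.
  have := @rout_bounds Dr o p i; have := @f_neq_o (rout Dr o p i); lia.
exists b; split => //; try lia.
- move=> i hi; have [hip|hip] := leqP i p.
    by have [z hz <-] := top_f i hip; apply: (ps_lt P); lia.
  rewrite back_bot //; have [|->|[k [hk <- _]]] := @cleft_range i; first by lia.
    by apply: (ps_lt P); lia.
  by apply: (ps_lt P); lia.
- rewrite so back_mid /rout ?eqxx /=; last by lia.
  have [|g1 g2 g3] := @prev_markP Dr o p; first by lia.
  by case/orP: g2 => [/eqP ->|].
- move=> i k ik kn e; have [hip|hip] := leqP i p; last first.
    by have := bot_inj i k; lia.
  have [hkp|hkp] := leqP k p; last first.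
    have [z hz ez] := top_f i hip; rewrite -ez (back_bot hkp) in e.
    have [|eq|[k' [hk' e' _]]] := @cleft_range k; first by lia.
      split; last first.
        by apply/eqP; apply: contraT => /eqP nb; have := s_neq_q k; rewrite back_bot //; lia.
      have [io|io] := leqP i o.
        have zi : f i = f o by rewrite -(back_top io) -ez; lia.
        by have := @ps_inj _ _ _ _ P i o; lia.
      by have := s_neq_q i; lia.
    by have := @ps_inj _ _ _ _ P z k'; lia.
  have [hio|hio] := leqP i o.
    rewrite back_top // in e; have [hko|hko] := leqP k o.
      by rewrite back_top // in e; have := @ps_inj _ _ _ _ P i k; lia.
    rewrite back_mid in e; last by lia.
    have := @rout_bounds Dr o p k => h.
    by have := @ps_inj _ _ _ _ P i (rout Dr o p k); lia.
  rewrite !back_mid in e; try lia.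
  have g1 := @rout_bounds Dr o p k; have g2 := @rout_bounds Dr o p i.
  have e2 : rout Dr o p i = rout Dr o p k by apply: (ps_inj P); lia.
  by have := congr1 (rin Dr o p) e2; rewrite !routK; lia.
- move=> i hi e; have [hip|hip] := leqP i p.
    have [z hz ez] := top_f i hip.
    by have := @ps_inj _ _ _ _ P z kc; lia.
  rewrite back_bot // in e; have [|e'|[k' [hk' e' ?]]] := @cleft_range i; lia.
Qed.

End Back.

(** A matrix determines a row function only on the rows below [n]; this lets [back] be applied to
    such a function. *)
Lemma eq_back f g o p c i : o < p < n -> (forall k, k < n -> f k = g k) ->
  i < n -> back f o p c i = back g o p c i.
Proof.
move=> hop efg hi.
rewrite /back; case: leqP => [hio|hio]; first exact: efg.
have eD z : o < z < p -> (f z.+1 < f o) = (g z.+1 < g o) by move=> hz; rewrite !efg //; lia.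
case: leqP => hip.
  have h := @rout_bounds (fun x => f x.+1 < f o) o p i.
  rewrite efg; last by lia.
  congr (g _); rewrite /rout; have [e|ne] := eqVneq i p.
    by congr _.+1; apply: eq_prev_mark => // z hz; apply: eD; lia.
  rewrite eD; last by lia.
  by case: ifP => // _; congr _.+1; apply: eq_prev_mark => // z hz; apply: eD; lia.
rewrite !efg; try lia.
rewrite /cleft; case: ifP => // h; apply: eq_prev_mark; first by lia.
move=> z hz; apply: eq_in_has => k; rewrite mem_index_iota => hk.
by rewrite efg //; lia.
Qed.

End Shapes.

(** * Counting *)

(** The inversion number, localized to a list of rows so that the top, middle and bottom blocks can
    be treated apart. *)
Definition linv (l : seq nat) (f : nat -> nat) : nat :=
  \sum_(i <- l) \sum_(k <- l) ((i < k) && (f k < f i)).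

Lemma linv_cat l1 l2 f : (forall i k, i \in l1 -> k \in l2 -> i < k) ->
  linv (l1 ++ l2) f =
  linv l1 f + linv l2 f + \sum_(i <- l1) \sum_(k <- l2) (f k < f i).
Proof.
move=> lt12; rewrite /linv big_cat /=.
under eq_bigr do rewrite big_cat /=.
under [X in _ + X]eq_bigr do rewrite big_cat /=.
rewrite !big_split /=.
have -> : \sum_(i <- l2) \sum_(k <- l1) ((i < k) && (f k < f i) : nat) = 0.
  rewrite big1_seq // => i /andP[_ hi]; rewrite big1_seq // => k /andP[_ hk].
  by have := lt12 _ _ hk hi; case: ltngtP.
have -> : \sum_(i <- l1) \sum_(k <- l2) ((i < k) && (f k < f i) : nat) =
          \sum_(i <- l1) \sum_(k <- l2) (f k < f i : nat).
  rewrite big_seq [RHS]big_seq; apply: eq_bigr => i hi.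
  rewrite big_seq [RHS]big_seq; apply: eq_bigr => k hk.
  by rewrite lt12.
by rewrite add0n -addnA [X in _ + X]addnC addnA.
Qed.

Lemma eq_linv l f g :
  (forall i k, i \in l -> k \in l -> (f k < f i) = (g k < g i)) ->
  linv l f = linv l g.
Proof.
move=> e; rewrite /linv big_seq [RHS]big_seq; apply: eq_bigr => i hi.
rewrite big_seq [RHS]big_seq; apply: eq_bigr => k hk.
by rewrite e.
Qed.

Lemma sum_nat_seq_eq (r : seq nat) (x : nat) : uniq r ->
  \sum_(k <- r) (k == x : nat) = (x \in r).
Proof.
move=> ur; rewrite -(count_uniq_mem x ur) -sum1_count [RHS]big_mkcond /=.
by apply: eq_bigr => k _; case: (k == x).
Qed.

Section Counting.
Variables (n : nat) (s : nat -> nat) (o p b c : nat).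
Hypothesis S : shape n s o p b c.
Let q := s o.
Let Dr x := s x < s o.
Let f := fwd n s o p c.
Let op := sh_op S. Let pb := sh_pb S. Let bn := sh_bn S. Let cn := sh_cn S.
Let sb := sh_b S. Let sa := sh_a S. Let qc := sh_q S.

(** Along the marks from [q] to [c], H vacates [q] and occupies [c]; the other columns occupied
    below row [p] remain the same. *)
Lemma perm_bot : perm_eq (q :: map f (index_iota p.+1 n)) (c :: map s (index_iota p.+1 n)).
Proof.
have P := fwd_pshape S.
apply: uniq_perm => /=.
- apply/andP; split.
    apply/mapP => -[k]; rewrite mem_index_iota => hk e.
    have := ps_inj P (i := o) (k := k); rewrite -/f -e /f fwd_top //; lia.
  rewrite map_inj_in_uniq ?iota_uniq // => i k.
  by rewrite !mem_index_iota => hi hk; apply: (ps_inj P); lia.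
- apply/andP; split.
    apply/mapP => -[k]; rewrite mem_index_iota => hk e.
    by have := sh_c S (i := k); lia.
  rewrite map_inj_in_uniq ?iota_uniq // => i k.
  rewrite !mem_index_iota => hi hk e.
  have := @sh_inj _ _ _ _ _ _ S i k; have := @sh_inj _ _ _ _ _ _ S k i; lia.
move=> x; rewrite !inE; apply/orP/orP => -[/eqP ->|/mapP[k]].
- right; apply/mapP; exists b => //; rewrite mem_index_iota; lia.
- rewrite mem_index_iota => hk ->; rewrite /f (fwd_bot S); last by lia.
  have [|->|[k' [hk' <- _]]] := @cright_range n s o p b c S k; first by lia.
    by left.
  by right; apply: map_f; rewrite mem_index_iota.
- right; have [k [hk <-]] := fwd_c S.
  by apply: map_f; rewrite mem_index_iota.
- rewrite mem_index_iota => hk ->.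
  have [->|nq] := eqVneq (s k) q; [by left|right].
  have [h|h] := boolP (q < s k < c).
    have : colmark n f p (s k) by rewrite (fwd_mark S) //; apply: colmark_row.
    case/colmarkP => k' [hk' <-].
    by apply: map_f; rewrite mem_index_iota.
  have <- : f k = s k.
    rewrite /f (fwd_bot S) /cright ?ifF //; last by lia.
    by have := sh_c S (i := k); lia.
  by apply: map_f; rewrite mem_index_iota.
Qed.

Lemma sum_bot (g : nat -> nat) :
  \sum_(p.+1 <= k < n) g (f k) + g q = \sum_(p.+1 <= k < n) g (s k) + g c.
Proof.
have := perm_big _ perm_bot (op := addn) (x := 0) (P := xpredT) (F := g).
by rewrite !big_cons !big_map addnC => ->; rewrite addnC.
Qed.

Lemma perm_rout : perm_eq (map (rout Dr o p) (index_iota o.+1 p.+1)) (index_iota o.+1 p.+1).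
Proof.
apply: uniq_perm; rewrite ?iota_uniq //.
  rewrite map_inj_in_uniq ?iota_uniq // => i k; rewrite !mem_index_iota => hi hk.
  by move/(congr1 (rin Dr o p)); rewrite !routK //; lia.
move=> x; apply/mapP/idP => [[k]|].
  by rewrite !mem_index_iota => hk ->; have := @rout_bounds Dr o p k; lia.
rewrite mem_index_iota => hx; exists (rin Dr o p x); last by rewrite rinK //; lia.
by rewrite mem_index_iota; have := @rin_bounds Dr o p x; lia.
Qed.

Lemma sum_rout (h : nat -> nat) :
  \sum_(o.+1 <= i < p.+1) h i = \sum_(o.+1 <= i < p.+1) h (rout Dr o p i).
Proof. by rewrite -(perm_big _ perm_rout) big_map. Qed.

Lemma sum_mid (g : nat -> nat) :
  \sum_(o.+1 <= i < p.+1) g (f i) = \sum_(o.+1 <= i < p.+1) g (s i).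
Proof.
rewrite sum_rout; rewrite big_nat [RHS]big_nat; apply: eq_bigr => i hi.
rewrite /f (fwd_mid S) ?routK //; try lia.
by have := @rout_bounds Dr o p i; rewrite /Dr; lia.
Qed.

Lemma mid_neq_q i : o < i <= p -> s i <> q.
Proof. by move=> h e; have := sh_eq_o S (i := i); lia. Qed.

(** Left rows keep their relative order under [rout], and so do right rows. A right row [i] moves
    down one row while the next left row is carried up past it, so exactly one inversion starting at
    [i] disappears. *)
Lemma rout_inversions i : o < i <= p ->
  \sum_(o.+1 <= k < p.+1) ((i < k) && (s k < s i) : nat) =
  \sum_(o.+1 <= k < p.+1) ((rout Dr o p i < rout Dr o p k) && (s k < s i) : nat)
  + (q < s i).
Proof.
move=> hi; have sq := mid_neq_q hi.
have Dp k : k = p -> Dr k by move=> ->.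
have rD k : Dr k -> rout Dr o p k = (prev_mark Dr o k).+1.
  by move=> Dk; rewrite /rout Dk orbT.
have rnD k : ~~ Dr k -> rout Dr o p k = k.+1.
  move=> Dk; rewrite /rout (negbTE Dk) orbF ifF //.
  by apply/negbTE; apply: contra Dk => /eqP ->.
have [qsi|qsi] := ltnP q (s i); last first.
  rewrite addn0 big_nat [RHS]big_nat; apply: eq_bigr => k hk.
  have [lt|] := ltnP (s k) (s i); last by rewrite !andbF.
  have Dk : Dr k by rewrite /Dr; lia.
  have Di : Dr i by rewrite /Dr; lia.
  rewrite !rD // !andbT ltnS.
  have [|k1 k2 k3] := @prev_markP Dr o k; first by lia.
  have [|i1 i2 i3] := @prev_markP Dr o i; first by lia.
  have ki := k3 i; have ik := i3 k; rewrite Dk in ik; rewrite Di in ki.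
  have [e|//] := eqVneq i k; first by rewrite e !ltnn.
  by have : ~~ (prev_mark Dr o k < i < k) /\ ~~ (prev_mark Dr o i < k < i);
     [split; apply/negP => /[dup] ?; [move/ki|move/ik]|lia].
have nDi : ~~ Dr i by rewrite /Dr -leqNgt; lia.
have ip : i != p by apply: contra nDi => /eqP ->.
have [|n1 n2 n3] := @next_markP Dr p i; first by lia.
have Dn : Dr (next_mark Dr p i) by case/orP: n2 => [/eqP /Dp|].
have -> : true = 1 :> nat by [].
(* The lost inversion is the one with the next left row, which exists because row [p] is left. *)
have -> : 1 = \sum_(o.+1 <= k < p.+1) (k == next_mark Dr p i : nat).
  by rewrite sum_nat_seq_eq ?iota_uniq // mem_index_iota; lia.
rewrite -big_split /= big_nat [RHS]big_nat; apply: eq_bigr => k hk.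
rewrite (rnD i) //; have [Dk|nDk] := boolP (Dr k); last first.
  rewrite rnD // ltnS; have [e|_] := eqVneq k (next_mark Dr p i); last by rewrite addn0.
  by rewrite e Dn in nDk.
have lt : s k < s i by move: Dk; rewrite /Dr; lia.
rewrite rD // ltnS lt !andbT.
have [|k1 k2 k3] := @prev_markP Dr o k; first by lia.
have pvi : prev_mark Dr o k <> i.
  by move=> e; rewrite e (negbTE nDi) orbF in k2; lia.
(* A left row [k] jumps over [i] exactly when its previous mark is above [i], that is, when [k] is
   the first mark after [i]. *)
have kk : (k == next_mark Dr p i) = (prev_mark Dr o k < i < k).
  apply/eqP/idP => [->|h]; last first.
    apply/esym; apply: next_mark_unique; [lia|by rewrite Dk orbT|].
    by move=> z hz; apply: k3; lia.
  have [|m1 m2 m3] := @prev_markP Dr o (next_mark Dr p i); first by lia.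
  have [h|h|h] := ltngtP (prev_mark Dr o (next_mark Dr p i)) i; first by lia.
    case/orP: m2 => [|m2]; first by lia.
    by rewrite n3 // in m2; lia.
  by rewrite h (negbTE nDi) orbF in m2; lia.
by rewrite kk; lia.
Qed.

Lemma linv_mid :
  linv (index_iota o.+1 p.+1) s =
  linv (index_iota o.+1 p.+1) f + \sum_(o.+1 <= i < p.+1) (q < s i).
Proof.
have -> : linv (index_iota o.+1 p.+1) f = \sum_(o.+1 <= i < p.+1) \sum_(o.+1 <= k < p.+1)
    ((rout Dr o p i < rout Dr o p k) && (s k < s i) : nat).
  rewrite /linv sum_rout big_nat [RHS]big_nat; apply: eq_bigr => i hi.
  rewrite sum_rout big_nat [RHS]big_nat; apply: eq_bigr => k hk.
  have hi' := @rout_bounds Dr o p i; have hk' := @rout_bounds Dr o p k.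
  rewrite /f !(fwd_mid S) ?routK //; rewrite /Dr in hi' hk' *; lia.
rewrite /linv -big_split /= big_nat [RHS]big_nat; apply: eq_bigr => i hi.
by apply: rout_inversions; lia.
Qed.

(** The middle block loses one inversion per right row. Top rows see the same middle values as
    before. H is increasing on the bottom values, which as a set trade [q] for [c]. *)
Lemma linv_fwd :
  linv (index_iota 0 n) s =
  linv (index_iota 0 n) f + \sum_(o.+1 <= i < p.+1) (q < s i)
  + \sum_(0 <= i < p.+1) (q < s i < c).
Proof.
set T := index_iota 0 o.+1; set M := index_iota o.+1 p.+1.
set B := index_iota p.+1 n.
have eTM : index_iota 0 p.+1 = T ++ M.
  rewrite /index_iota (_ : p.+1 - 0 = o.+1 + (p - o)) ?iotaD; last by lia.
  by rewrite /T /M /index_iota !subn0 subSS.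
have eTMB : index_iota 0 n = (T ++ M) ++ B.
  rewrite -eTM /index_iota (_ : n - 0 = p.+1 + (n - p.+1)) ?iotaD; last by lia.
  by rewrite /B /index_iota !subn0.
have lt1 : forall i k, i \in T ++ M -> k \in B -> i < k.
  by move=> i k; rewrite -eTM !mem_index_iota; lia.
have lt2 : forall i k, i \in T -> k \in M -> i < k.
  by move=> i k; rewrite !mem_index_iota; lia.
(* Replacing [q] by [c] among the bottom values lowers the number of values below [x] by one exactly
   when [q < x < c]. *)
have key x : x <> c -> \sum_(k <- B) (s k < x) = \sum_(k <- B) (f k < x) + (q < x < c).
  move=> xc; have := sum_bot (fun y => y < x : nat) => /= e.
  have h1 : (q < x : nat) = (q < x < c) + (c < x) by lia.
  by move: e; rewrite -/B; lia.
rewrite eTM eTMB !linv_cat // linv_mid.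
have -> : linv T s = linv T f.
  apply: eq_linv => i k; rewrite !mem_index_iota => hi hk.
  by rewrite /f !fwd_top //; lia.
have -> : linv B s = linv B f.
  apply: eq_linv => i k; rewrite !mem_index_iota => hi hk.
  have h1 := fwd_mono S hi hk; have h2 := fwd_mono S hk hi.
  have [h|h|h] := ltngtP (s k) (s i).
  - by rewrite h2.
  - by have := h1 h; rewrite -/f; lia.
  - have : k = i by have := @sh_inj _ _ _ _ _ _ S i k; have := @sh_inj _ _ _ _ _ _ S k i; lia.
    by move=> ->; rewrite ltnn.
have -> : \sum_(i <- T) \sum_(k <- M) (s k < s i) = \sum_(i <- T) \sum_(k <- M) (f k < f i).
  rewrite big_seq [RHS]big_seq; apply: eq_bigr => i; rewrite mem_index_iota => hi.
  rewrite [f i]/f fwd_top; last by lia.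
  by rewrite (sum_mid (fun y => y < s i : nat)).
have -> : \sum_(i <- T ++ M) \sum_(k <- B) (s k < s i) =
   \sum_(i <- T ++ M) \sum_(k <- B) (f k < f i) + \sum_(i <- T ++ M) (q < s i < c).
  have -> : \sum_(i <- T ++ M) \sum_(k <- B) (f k < f i) =
            \sum_(i <- T ++ M) \sum_(k <- B) (f k < s i).
    rewrite !big_cat /= (sum_mid (fun y => \sum_(k <- B) (f k < y))).
    congr (_ + _); rewrite big_seq [RHS]big_seq; apply: eq_bigr => i.
    by rewrite mem_index_iota => hi; rewrite [f i]/f fwd_top; last by lia.
  rewrite -eTM -big_split big_nat [RHS]big_nat; apply: eq_bigr => i hi.
  by rewrite key //; apply: (sh_c S); lia.
rewrite -/M; move: (linv T f) (linv M f) (linv B f) (\sum_(i <- M) _) => x1 x2 x3 x4.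
move: (\sum_(i <- T) _) (\sum_(i <- T ++ M) (_ < _ < c)) (\sum_(i <- T ++ M) _) => x5 x6 x7.
by clear; lia.
Qed.

(** Row [p] may join the sum over [s] because [s p < q]; after that the middle values are merely
    permuted. *)
Lemma charged_fwd : \sum_(o.+1 <= i < p) (q < s i) = \sum_(o.+1 <= i < p.+1) (q < f i).
Proof.
rewrite (sum_mid (fun y => q < y : nat)) big_nat_recr //=.
have -> : (q < s p) = false by rewrite ltnNge ltnW.
by rewrite addn0.
Qed.

(** The extra unit is the column [c], occupied below row [p] in exchange for [q]. *)
Lemma cval_fwd : (\sum_(p.+1 <= k < n) (q < s k < c)).+1 = \sum_(p.+1 <= k < n) (q < f k <= c).
Proof.
have /= := sum_bot (fun y => q < y <= c : nat); rewrite ltnn leqnn qc addn0 => ->.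
rewrite addn1; congr _.+1; rewrite big_nat [RHS]big_nat; apply: eq_bigr => k hk.
by have := sh_c S (i := k); lia.
Qed.

(** The exchange of [q] for [c] is invisible in a window of columns strictly left of [q]. *)
Lemma ell_fwd x : \sum_(o.+1 <= i < n) (x < s i < q) = \sum_(o.+1 <= i < n) (x < f i < q).
Proof.
have split_sum g : \sum_(o.+1 <= i < n) g i =
    \sum_(o.+1 <= i < p.+1) g i + \sum_(p.+1 <= i < n) g i.
  by rewrite -big_cat_nat //=; lia.
rewrite !split_sum.
rewrite (sum_mid (fun y => x < y < q : nat)); congr (_ + _).
have /= := sum_bot (fun y => x < y < q : nat).
have -> : (c < q) = false by apply/negbTE; rewrite -leqNgt ltnW.
by rewrite ltnn !andbF !addn0.
Qed.

End Counting.

(** * Matrices of shapes *)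

Lemma the_nat_unique n (P : pred nat) j : j < n -> P j ->
  (forall k, k < n -> P k -> k = j) -> the_nat n P = j.
Proof.
move=> jn Pj uj; rewrite /the_nat.
suff -> : [seq i <- iota 0 n | P i] = [:: j] by [].
apply: (irr_sorted_eq ltn_trans ltnn); rewrite ?(sorted_filter ltn_trans) ?iota_ltn_sorted //.
move=> k; rewrite mem_filter mem_iota inE /= add0n.
by apply/andP/eqP => [[Pk kn]|->]; [apply: uj|].
Qed.

Lemma entry_matrix n (F : nat -> nat -> int) i j : i < n -> j < n ->
  entry (\matrix_(i < n, j < n) F i j) i j = F i j.
Proof. by move=> hi hj; rewrite /entry !insubT mxE. Qed.

Lemma entry_ord n (A : 'M[int]_n) (i j : 'I_n) : entry A i j = A i j.
Proof. by rewrite /entry !valK. Qed.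

Lemma matrix_entryP n (A B : 'M[int]_n) :
  (forall i j, i < n -> j < n -> entry A i j = entry B i j) -> A = B.
Proof. by move=> e; apply/matrixP => i j; rewrite -!entry_ord e. Qed.

Lemma alt_row n (A : 'M[int]_n) (i : 'I_n) :
  alt_ok [seq A i j | j <- enum 'I_n] = alt_ok [seq entry A i j | j <- iota 0 n].
Proof.
rewrite -val_enum_ord -map_comp; congr alt_ok.
by apply: eq_map => j /=; rewrite entry_ord.
Qed.

Lemma alt_col n (A : 'M[int]_n) (j : 'I_n) :
  alt_ok [seq A i j | i <- enum 'I_n] = alt_ok [seq entry A i j | i <- iota 0 n].
Proof.
rewrite -val_enum_ord -map_comp; congr alt_ok.
by apply: eq_map => i /=; rewrite entry_ord.
Qed.

Lemma alt_ok_support (g : nat -> int) n u :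
  sorted ltn u -> (forall k, (k < n) && (g k != 0%R) = (k \in u)) ->
  (forall k, k < n -> g k \in [:: (-1)%R; 0%R; 1%R]) ->
  alt_ok [seq g k | k <- iota 0 n] =
  [&& map g u != [::], head 0%R (map g u) == 1%R, last 0%R (map g u) == 1%R &
      path (fun x y => y == (- x)%R) (head 0%R (map g u)) (behead (map g u))].
Proof.
move=> su eu range; rewrite /alt_ok filter_map.
have -> : [seq k <- iota 0 n | preim g (fun x => x != 0%R) k] = u.
  apply: (irr_sorted_eq ltn_trans ltnn); rewrite ?(sorted_filter ltn_trans) ?iota_ltn_sorted //.
  by move=> k; rewrite mem_filter mem_iota add0n -eu andbC.
have -> // : all (fun x => x \in [:: (-1)%R; 0%R; 1%R]) [seq g k | k <- iota 0 n].
by apply/allP => x /mapP [k]; rewrite mem_iota => hk ->; apply: range.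
Qed.

Lemma alt_ok_single (g : nat -> int) n j : j < n ->
  (forall k, k < n -> g k = (k == j)%:Z) -> alt_ok [seq g k | k <- iota 0 n].
Proof.
move=> jn e; rewrite (@alt_ok_support g n [:: j]) //.
- by rewrite /= e // eqxx.
- move=> k; rewrite inE; have [kn|kn] /= := ltnP k n; last by lia.
  by rewrite e //; case: (k == j).
- by move=> k kn; rewrite e //; case: (k == j).
Qed.

Lemma alt_ok_triple (g : nat -> int) n a q c : a < q -> q < c -> c < n ->
  (forall k, k < n -> g k = ((k == a)%:Z + (k == c)%:Z - (k == q)%:Z)%R) ->
  alt_ok [seq g k | k <- iota 0 n].
Proof.
move=> aq qc cn e; rewrite (@alt_ok_support g n [:: a; q; c]) /=.
- rewrite !e; try lia.
- by rewrite aq qc.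
- move=> k; rewrite !inE; have [kn|kn] /= := ltnP k n; last by lia.
  by rewrite e //; lia.
- by move=> k kn; rewrite e // !inE; lia.
Qed.

(** Starting the alternation from a fictitious -1 absorbs the requirement that the first nonzero
    entry be 1. *)
Lemma alt_ok_inv (g : nat -> int) n : alt_ok [seq g k | k <- iota 0 n] ->
  exists u, [/\ sorted ltn u, forall k, (k < n) && (g k != 0%R) = (k \in u),
   map g u != [::], last 0%R (map g u) = 1%R &
   path (fun x y => y == (- x)%R) (-1)%R (map g u)].
Proof.
rewrite /alt_ok filter_map; set u := filter _ _ => /and5P[h1 h2 h3 h4 h5].
exists u; split => //.
- by rewrite /u (sorted_filter ltn_trans) ?iota_ltn_sorted.
- by move=> k; rewrite /u mem_filter mem_iota add0n andbC.
- exact/eqP.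
by move: h2 h3 h5; case: (map g u) => //= x l _ /eqP -> ->; rewrite opprK eqxx.
Qed.

Lemma alt_ok_no_minus (g : nat -> int) n : alt_ok [seq g k | k <- iota 0 n] ->
  (forall k, k < n -> g k != (-1)%R) ->
  exists2 j, j < n & forall k, k < n -> g k = (k == j)%:Z.
Proof.
move=> /alt_ok_inv [[|j [|l u]] [su eu //= _ e1 e2]] nm.
- have := eu j; rewrite inE eqxx => /andP[jn _]; exists j => // k kn.
  have := eu k; rewrite kn inE /=; have [->|nk] := eqVneq k j; first by rewrite e1.
  by move/negbT; rewrite negbK => /eqP.
- case/and3P: e2 => /eqP ej /eqP el _; have := eu l; rewrite !inE eqxx orbT => /andP[ln _].
  by have := nm l ln; rewrite el ej.
Qed.

(** The signs along the support are 1, -1, 1, and so on. Length 1 has no -1, length 2 does not end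
    on 1, and a fourth entry would be a second -1. *)
Lemma alt_ok_one_minus (g : nat -> int) n q : alt_ok [seq g k | k <- iota 0 n] ->
  q < n -> g q = (-1)%R -> (forall k, k < n -> g k = (-1)%R -> k = q) ->
  exists a c, [/\ a < q, q < c, c < n &
    forall k, k < n -> g k = ((k == a)%:Z + (k == c)%:Z - (k == q)%:Z)%R].
Proof.
move=> /alt_ok_inv [[|x [|y [|z [|w u]]]] [su eu //= _ e1 e2]] qn gq uq.
- have := eu q; rewrite qn gq inE /= => /esym /eqP qx; rewrite qx e1 in gq; lia.
- by case/and3P: e2 => /eqP ex /eqP ey _; lia.
- case/and4P: e2 => /eqP ex /eqP ey /eqP ez _.
  have ux := eu x; have uy := eu y; have uz := eu z.
  rewrite !inE eqxx ?orbT in ux uy uz.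
  have yq : y = q by apply: uq; lia.
  case/and3P: su => xy yz _; exists x, z; split; try lia.
  move=> k kn; have := eu k; rewrite kn !inE /=.
  have [->|kx] := eqVneq k x; first by lia.
  have [->|ky] := eqVneq k y; first by lia.
  have [->|kz] := eqVneq k z; first by lia.
  by move=> /= /negbT; rewrite negbK => /eqP ->; lia.
- case/and5P: e2 => /eqP ex /eqP ey /eqP ez /eqP ew _.
  have uy := eu y; have uw := eu w.
  rewrite !inE eqxx ?orbT in uy uw.
  have yq : y = q by apply: uq; lia.
  have wq : w = q by apply: uq; lia.
  case/and4P: su => xy yz zw _; lia.
Qed.

Definition cell s p q c (i j : nat) : int :=
  ((s i == j :> nat)%:Z + (if i == p then (j == c)%:Z - (j == q)%:Z else 0))%R.

Definition shape_mx n s o p c : 'M[int]_n := \matrix_(i < n, j < n) cell s p (s o) c i j.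

Definition fun_mx n (f : nat -> nat) : 'M[int]_n := \matrix_(i < n, j < n) (f i == j :> nat)%:Z.

Lemma entry_shape_mx n s o p c i j : i < n -> j < n -> entry (shape_mx n s o p c) i j = cell s p (s o) c i j.
Proof. exact: entry_matrix. Qed.

Lemma entry_fun_mx n f i j : i < n -> j < n -> entry (fun_mx n f) i j = (f i == j)%:Z.
Proof. exact: (@entry_matrix n (fun i j => (f i == j)%:Z)). Qed.

(** * Invariants of a matrix read from its shape *)

Section Mk.
Variables (n : nat) (s : nat -> nat) (o p b c : nat).
Hypothesis S : shape n s o p b c.
Let q := s o.
Let A := shape_mx n s o p c.
Let op := sh_op S. Let pb := sh_pb S. Let bn := sh_bn S. Let cn := sh_cn S.
Let sb := sh_b S. Let sa := sh_a S. Let qc := sh_q S.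

(** Pigeonhole: [c] and the values of [s] on the rows other than [b] are [n] distinct columns. *)
Lemma shape_onto j : j < n -> j <> c -> exists2 i, i < n & s i = j.
Proof.
move=> jn jc; pose l := c :: [seq s i | i <- rem b (iota 0 n)].
have mr i : (i \in rem b (iota 0 n)) = (i != b) && (i < n).
  by rewrite mem_rem_uniq ?iota_uniq // !inE mem_iota.
have ul : uniq l.
  rewrite /= map_inj_in_uniq ?rem_uniq ?iota_uniq // ?andbT.
    apply/mapP => -[i]; rewrite mr => hi e.
    by have := sh_c S (i := i); lia.
  move=> i k; rewrite !mr => hi hk e.
  have := @sh_inj _ _ _ _ _ _ S i k; have := @sh_inj _ _ _ _ _ _ S k i; lia.
have sl : {subset l <= iota 0 n}.
  move=> x; rewrite inE mem_iota => /orP[/eqP ->|/mapP[i]]; first by rewrite add0n.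
  by rewrite mr => hi ->; have := sh_lt S (i := i); lia.
have zl : size (iota 0 n) <= size l.
  by rewrite /= size_map size_rem ?mem_iota ?size_iota //; lia.
have [_ el] := uniq_min_size ul sl zl.
have : j \in l by rewrite el mem_iota.
rewrite inE => /orP[/eqP //|/mapP[i]]; rewrite mr => hi ->; exists i => //; lia.
Qed.

Lemma column_cases j : j < n -> j <> q ->
  exists2 i0, i0 < n & forall i, i < n -> cell s p q c i j = (i == i0)%:Z.
Proof.
move=> jn jq; have [->|/eqP nc] := eqVneq j c.
  exists p; first by lia.
  move=> i hi; rewrite /cell eqxx; have := sh_c S hi.
  by have [->|] := eqVneq i p; rewrite ?eqxx; lia.
have [i0 hi0 e0] := shape_onto jn nc; exists i0 => // i hi.
have jc : (j == c) = false by apply/eqP.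
rewrite /cell jc; have -> : (j == q) = false by apply/eqP.
rewrite if_same addr0; congr (nat_of_bool _)%:Z; apply/eqP/eqP => [e|->//].
have := @sh_inj _ _ _ _ _ _ S i i0; have := @sh_inj _ _ _ _ _ _ S i0 i.
rewrite e e0 => h1 h2; have [h|h|//] := ltngtP i i0.
  by case: (h2 h hi0 erefl) => io _; case: jq; rewrite -e io.
by case: (h1 h hi erefl) => io _; case: jq; rewrite -e0 io.
Qed.

Lemma column_q i : i < n -> cell s p q c i q = ((i == o)%:Z + (i == b)%:Z - (i == p)%:Z)%R.
Proof.
move=> hi; rewrite /cell.
have -> : (s i == q) = (i == o) || (i == b).
  apply/eqP/orP => [/(sh_eq_o S hi)[->|->]|[/eqP ->|/eqP ->]]; rewrite ?eqxx; auto.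
have qc' : q < c by [].
by case: (i =P p); rewrite ?eqxx; lia.
Qed.

Lemma row_p j : cell s p q c p j = ((j == s p)%:Z + (j == c)%:Z - (j == q)%:Z)%R.
Proof. by rewrite /cell eqxx eq_sym; lia. Qed.

Lemma row_other i j : i <> p -> cell s p q c i j = (s i == j)%:Z.
Proof. by move/eqP/negbTE => ip; rewrite /cell ip addr0. Qed.

Lemma cell_minus i j : i < n -> (cell s p q c i j == (-1)%R) = (i == p) && (j == q).
Proof. by move=> hi; rewrite /cell; have := sh_c S hi; case: (i =P p) => [->|]; lia. Qed.

Lemma shape_mx_inA1 : inA1 A.
Proof.
have pn : p < n by lia.
have qn : q < n by lia.
rewrite /inA1 /inAns /is_asm; apply/andP; split; [apply/andP; split|].
- apply/forallP => i; rewrite alt_row.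
  have [e|/eqP ne] := eqVneq (val i) p.
    apply: (@alt_ok_triple _ _ (s p) q c) => // j hj.
    by rewrite e entry_shape_mx // row_p.
  apply: (@alt_ok_single _ _ (s i)); first by apply: sh_lt S _ _.
  by move=> j hj; rewrite entry_shape_mx // row_other // eq_sym.
- apply/forallP => j; rewrite alt_col.
  have [e|/eqP ne] := eqVneq (val j) q.
    apply: (@alt_ok_triple _ _ o p b) => // i hi.
    by rewrite e entry_shape_mx // column_q.
  have [i0 hi0 e] := column_cases (ltn_ord j) ne.
  by apply: (@alt_ok_single _ _ i0) => // i hi; rewrite entry_shape_mx // e.
- rewrite /nminus (_ : [set ij | _] = [set (Ordinal pn, Ordinal qn)]) ?cards1 //.
  apply/setP => -[i j]; rewrite !inE /= mxE cell_minus //.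
Qed.

Lemma crow_shape_mx : crow A = p.
Proof.
apply: the_nat_unique; first by lia.
  apply/hasP; exists q; first by rewrite mem_iota; lia.
  by rewrite entry_shape_mx ?cell_minus ?eqxx //; lia.
move=> i hi /hasP [j]; rewrite mem_iota => hj.
by rewrite entry_shape_mx // cell_minus // => /andP[/eqP].
Qed.

Lemma ocol_shape_mx : ocol A = q.
Proof.
apply: the_nat_unique; first by lia.
  apply/hasP; exists p; first by rewrite mem_iota; lia.
  by rewrite entry_shape_mx ?cell_minus ?eqxx //; lia.
move=> j hj /hasP [i]; rewrite mem_iota => hi.
by rewrite entry_shape_mx // cell_minus // => /andP[_ /eqP].
Qed.

Lemma orow_shape_mx : orow A = o.
Proof.
apply: the_nat_unique; first by lia.
  rewrite crow_shape_mx ocol_shape_mx entry_shape_mx ?column_q ?op /=; lia.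
move=> i hi; rewrite crow_shape_mx ocol_shape_mx entry_shape_mx ?column_q; lia.
Qed.

Lemma ccol_shape_mx : ccol A = c.
Proof.
apply: the_nat_unique => //.
  rewrite crow_shape_mx ocol_shape_mx entry_shape_mx ?row_p; lia.
move=> i hi; rewrite crow_shape_mx ocol_shape_mx entry_shape_mx ?row_p; lia.
Qed.

Lemma one_col_shape_mx i : i < n -> i <> p -> one_col A i = s i.
Proof.
move=> hi ip; apply: the_nat_unique; first exact: (sh_lt S).
  by rewrite entry_shape_mx ?row_other ?eqxx //; apply: (sh_lt S).
by move=> j hj; rewrite entry_shape_mx ?row_other //; lia.
Qed.

Lemma neutral_shape_mx : neutral A = (o.+1 == p).
Proof. by rewrite /neutral orow_shape_mx crow_shape_mx. Qed.

Lemma positive_shape_mx : positive A = (o.+1 < p) && (q < s p.-1).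
Proof.
rewrite /positive orow_shape_mx crow_shape_mx ocol_shape_mx; have [h /=|//] := ltnP o.+1 p.
by rewrite one_col_shape_mx //; lia.
Qed.

Lemma negative_shape_mx : negative A = (o.+1 < p) && (s p.-1 < q).
Proof.
rewrite /negative orow_shape_mx crow_shape_mx ocol_shape_mx; have [h /=|//] := ltnP o.+1 p.
by rewrite one_col_shape_mx //; lia.
Qed.

Lemma sign_shape_mx : [|| positive A, neutral A | negative A].
Proof.
rewrite positive_shape_mx neutral_shape_mx negative_shape_mx.
have := @mid_neq_q _ _ _ _ _ _ S p.-1; lia.
Qed.

Lemma sum_row i x y : i <> p -> i < n -> y <= n ->
  (\sum_(x <= j < y) entry A i j = (x <= s i < y)%N%:Z)%R.
Proof.
move=> ip hi yn; rewrite big_nat.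
under eq_bigr => j hj.
  rewrite entry_shape_mx //; last by lia.
  rewrite row_other // eq_sym; over.
rewrite -big_nat -(big_morph Posz PoszD (erefl _)); congr Posz.
by rewrite sum_nat_seq_eq ?iota_uniq // mem_index_iota.
Qed.

Lemma charged_shape_mx : charged_sum A = (\sum_(o.+1 <= i < p) (q < s i))%N%:Z.
Proof.
rewrite /charged_sum orow_shape_mx crow_shape_mx ocol_shape_mx (big_morph Posz PoszD (erefl _)).
apply: eq_big_nat => i hi.
rewrite sum_row //; try lia.
have := sh_lt S (i := i); lia.
Qed.

Lemma cval_shape_mx : cval A = (\sum_(p.+1 <= i < n) (q < s i < c))%N%:Z.
Proof.
rewrite /cval crow_shape_mx ocol_shape_mx ccol_shape_mx (big_morph Posz PoszD (erefl _)).
by apply: eq_big_nat => i hi; rewrite sum_row //; lia.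
Qed.

(** The search for the leading 1 runs over all lower rows, but it stops at [p] at the latest, since
    row [p] has a left 1; so it agrees with the search bounded by [p]. *)
Lemma lead_row_shape_mx : lead_row A = next_mark (fun x => s x < q) p o.
Proof.
rewrite /lead_row orow_shape_mx.
set Q := (X in find X _).
have QE i : i < n -> Q i = (s i < q).
  move=> hi; have sn := sh_lt S hi; apply/hasP/idP => [[j]|h].
    rewrite mem_iota ocol_shape_mx => hj; rewrite entry_shape_mx //.
    have [->|/eqP ip] := eqVneq i p; first by rewrite row_p; lia.
    by rewrite row_other //; lia.
  exists (s i); first by rewrite mem_iota.
  rewrite ocol_shape_mx h entry_shape_mx //.
  have [->|/eqP ip] := eqVneq i p; first by rewrite row_p eqxx; lia.
  by rewrite row_other // eqxx.
have <- : next_mark Q n o = next_mark (fun x => s x < q) p o; last by rewrite /next_mark.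
have [|h1 h2 h3] := @next_markP (fun x => s x < q) p o; first by lia.
apply: next_mark_unique; first by lia.
  rewrite QE; last by lia.
  by case/orP: h2 => [/eqP ->|->]; rewrite ?sa orbT.
by move=> z hz; rewrite QE ?h3 //; lia.
Qed.

(** V and the lowering bring the leading 1 to row [o+1]. Its column is therefore visible in the
    discharged matrix, which makes [ell] a function of [o] and [f]. *)
Lemma lead_col_shape_mx : lead_col A = fwd n s o p c o.+1.
Proof.
rewrite /lead_col lead_row_shape_mx ocol_shape_mx (fwd_mid S); last by lia.
rewrite /rin eqxx /=.
have [|h1 h2 h3] := @next_markP (fun x => s x < q) p o; first by lia.
rewrite -/q; set r := next_mark _ _ _ in h1 h2 h3 *.
have rn : r < n by lia.
have sr : s r < q by case/orP: h2 => [/eqP ->|//].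
have srn := sh_lt S rn.
apply: the_nat_unique => //.
  rewrite entry_shape_mx // sr /=.
  have [->|/eqP ip] := eqVneq r p; first by rewrite row_p eqxx; lia.
  by rewrite row_other // eqxx.
move=> j hj; rewrite entry_shape_mx //.
have [->|/eqP ip] := eqVneq r p; first by rewrite row_p; lia.
by rewrite row_other //; lia.
Qed.

Lemma ell_shape_mx : let f := fwd n s o p c in
  ell A = (\sum_(o.+1 <= i < n) (f o.+1 < f i < f o))%N%:Z.
Proof.
move=> f; rewrite /ell lead_col_shape_mx ocol_shape_mx orow_shape_mx -/f.
have -> : f o = q by rewrite /f fwd_top.
rewrite -(ell_fwd S) (big_morph Posz PoszD (erefl _)).
apply: eq_big_nat => i hi.
have [e|/eqP ne] := eqVneq i p; last by rewrite sum_row //; lia.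
(* In row [p] the -1 and the closing 1 lie outside the window of columns, so this row too counts
   only its left 1. *)
have eE j : f o.+1 < j < q -> entry A i j = (j == s p)%:Z.
  by move=> hj; rewrite e entry_shape_mx ?row_p; lia.
rewrite (eq_big_nat _ _ eE) -(big_morph Posz PoszD (erefl _)) e; congr Posz.
by rewrite sum_nat_seq_eq ?iota_uniq // mem_index_iota.
Qed.

End Mk.

(** A line without -1 has a single nonzero entry, a 1; row [p] and column [q] read 1, -1, 1. Hence
    two rows can share a value of [s] only in column [q], where they are [o] and [b]. *)
Lemma inA1_shape_mx n (A : 'M[int]_n) : inA1 A ->
  exists s o p b c, shape n s o p b c /\ A = shape_mx n s o p c.
Proof.
rewrite /inA1 /inAns /is_asm => /andP[/andP[/forallP hr /forallP hc] hm].
case/cards1P: hm => -[p q] hpq.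
have nm (i j : nat) : i < n -> j < n -> (entry A i j == (-1)%R) = (i == p) && (j == q).
  move=> hi hj; have /setP/(_ (Ordinal hi, Ordinal hj)) := hpq.
  by rewrite !inE /= -entry_ord /= => ->; rewrite xpair_eqE -!val_eqE.
have row1 (i : nat) : i < n -> i <> p ->
    exists2 j, j < n & forall k, k < n -> entry A i k = (k == j)%:Z.
  move=> hi ip; apply: alt_ok_no_minus.
    by have := hr (Ordinal hi); rewrite alt_row.
  by move=> k hk; rewrite nm //; lia.
have col1 (j : nat) : j < n -> j <> q ->
    exists2 i, i < n & forall k, k < n -> entry A k j = (k == i)%:Z.
  move=> hi ip; apply: (@alt_ok_no_minus (fun k => entry A k j)).
    by have := hc (Ordinal hi); rewrite alt_col.
  by move=> k hk; rewrite nm //; lia.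
have [a [c [aq qc cn rowp]]] : exists a c, [/\ a < q, q < c, c < n &
    forall k, k < n -> entry A p k = ((k == a)%:Z + (k == c)%:Z - (k == q :> nat)%:Z)%R].
  apply: alt_ok_one_minus => //.
  - by rewrite -alt_row.
  - by apply/eqP; rewrite nm ?eqxx.
  - by move=> k hk /eqP; rewrite nm // => /andP[_ /eqP].
have [o [b [op pb bn colq]]] : exists o b, [/\ o < p, p < b, b < n &
    forall k, k < n -> entry A k q = ((k == o)%:Z + (k == b)%:Z - (k == p :> nat)%:Z)%R].
  apply: (@alt_ok_one_minus (fun k => entry A k q)) => //.
  - by rewrite -alt_col.
  - by apply/eqP; rewrite nm ?eqxx.
  - by move=> k hk /eqP; rewrite nm // => /andP[/eqP].
(* Of the two 1's of row [p], the function records the left one; the right one is [c]. *)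
pose s i := if i == p :> nat then a else one_col A i.
have sp : s p = a by rewrite /s eqxx.
have sE i : i < n -> i <> p -> s i < n /\ forall k, k < n -> entry A i k = (s i == k)%:Z.
  move=> hi ip; have [j jn e] := row1 i hi ip.
  have -> : s i = j.
    rewrite /s ifF; last by apply/eqP.
    apply: the_nat_unique => //; first by rewrite e ?eqxx.
    by move=> k hk; rewrite e //; lia.
  by split=> // k hk; rewrite e // eq_sym.
have s1 i : i < n -> s i < n /\ entry A i (s i) = 1%R.
  move=> hi; have [e|/eqP ip] := eqVneq i p.
    by rewrite e sp rowp; lia.
  by have [h1 h2] := sE i hi ip; split=> //; rewrite h2 // eqxx.
have so : s o = q.
  have [||h1 h2] := sE o; [lia|lia|].
  have := colq o; rewrite h2 //; lia.
have sb : s b = q.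
  have [||h1 h2] := sE b; [lia|lia|].
  have := colq b; rewrite h2 //; lia.
have qn := ltn_ord q; have pn := ltn_ord p.
exists s, o, p, b, c; split.
  split; rewrite ?so ?sb ?sp //.
  - by move=> i /s1 [].
  - move=> i k ik kn e; have [|i1 i2] := s1 i; first by lia.
    have [k1 k2] := s1 k kn; rewrite -e in k2.
    have [eq|/eqP nq] := eqVneq (s i) q.
      rewrite eq in i2 k2.
      have := colq i; have := colq k; lia.
    have [x xn ex] := col1 _ i1 nq.
    have := ex i; have := ex k; lia.
  - move=> i hi e; have [i1 i2] := s1 i hi; rewrite e in i2.
    have [|x xn ex] := col1 _ cn; first by lia.
    have := rowp c cn; rewrite ex // => h1.
    rewrite ex // in i2; have ip : i = p by lia.
    by move: e; rewrite ip sp; lia.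
apply: matrix_entryP => i j hi hj; rewrite entry_shape_mx // /cell so.
have [->|/eqP ip] := eqVneq i p; last by have [_ ->] := sE i hi ip; rewrite ?addr0.
by rewrite rowp // sp; lia.
Qed.

(** * The partial discharging procedure *)

(** H and V match a list of marks with its shift by one place, [lo] being added at one end and [hi]
    at the other. Equal positions then hold consecutive marks. *)
Lemma nth_index_prev_mark D lo hi y : lo < hi ->
  let t := [seq x <- iota lo.+1 (hi - lo.+1) | D x] in
  y \in rcons t hi -> nth 0 (lo :: t) (index y (rcons t hi)) = prev_mark D lo y.
Proof.
move=> lh /=; have -> : hi = lo.+1 + (hi - lo.+1) by lia.
move: (hi - lo.+1) => m; rewrite addKn {lh hi}; elim: m y => [|m IH] y.
  by rewrite /= addn0 inE => /eqP ->; rewrite eqxx /= leqnn.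
have -> : iota lo.+1 m.+1 = rcons (iota lo.+1 m) (lo.+1 + m).
  by rewrite -cats1 -[m.+1]addn1 iotaD.
rewrite filter_rcons addnS.
set t := [seq x <- _ | _] in IH *; set h := lo.+1 + m in IH *.
have ht : h \notin t by rewrite mem_filter mem_iota; lia.
have hSt : h.+1 \notin t by rewrite mem_filter mem_iota; lia.
have pvS : prev_mark D lo h.+1 = if D h then h else prev_mark D lo h.
  by rewrite /= (_ : h <= lo = false) //; rewrite /h; lia.
have idx x u : x \notin u -> index x (rcons u x) = size u.
  by move=> xu; rewrite -cats1 index_cat (negbTE xu) /= eqxx addn0.
have nthl : nth 0 (lo :: t) (size t) = prev_mark D lo h.
  by rewrite -(IH h) ?idx // mem_rcons mem_head.
case: ifP => Dh; rewrite mem_rcons inE => /orP[/eqP ->|hy].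
- rewrite pvS Dh idx; first by rewrite -rcons_cons nth_rcons size_rcons /= ltnn eqxx.
  by rewrite mem_rcons inE negb_or hSt andbT /h; lia.
- rewrite -(IH y) // -[rcons (rcons _ _) _]cats1 index_cat hy.
  rewrite -rcons_cons nth_rcons /= ifT //.
  by rewrite -[X in _ < X](size_rcons t h) index_mem.
- by rewrite pvS Dh idx.
have := IH y; rewrite mem_rcons inE hy orbT => <- //.
by rewrite -!cats1 !index_cat hy.
Qed.

Lemma nth_index_next_mark D lo hi x : lo < hi ->
  let t := [seq x <- iota lo.+1 (hi - lo.+1) | D x] in
  x \in lo :: t -> nth 0 (rcons t hi) (index x (lo :: t)) = next_mark D hi x.
Proof.
move=> lh t hx; set k := index _ _.
have hk : k < size (rcons t hi) by move: hx; rewrite -index_mem size_rcons.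
have ut : uniq (rcons t hi).
  by rewrite rcons_uniq filter_uniq ?iota_uniq // andbT mem_filter mem_iota; lia.
have my : nth 0 (rcons t hi) k \in rcons t hi by rewrite mem_nth.
have := nth_index_prev_mark lh my; rewrite index_uniq // nth_index // => ->.
rewrite (@prev_markK D lo hi) //; move: my; rewrite mem_rcons inE mem_filter mem_iota; lia.
Qed.

Lemma iota_ends lo hi : lo < hi ->
  iota lo (hi - lo).+1 = lo :: rcons (iota lo.+1 (hi - lo.+1)) hi.
Proof.
move=> lh; rewrite -cats1 (_ : hi - lo = hi - lo.+1 + 1) ?[in LHS]/=; last by lia.
by rewrite iotaD /= addSn; congr (_ :: _ ++ [:: _]); lia.
Qed.

Section Delta.
Variables (n : nat) (s : nat -> nat) (o p b c : nat).
Hypothesis S : shape n s o p b c.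
Let q := s o.
Let A := shape_mx n s o p c.
Let Dr x := s x < s o.
Let Dc := colmark n s p.
Let op := sh_op S. Let pb := sh_pb S. Let bn := sh_bn S. Let cn := sh_cn S.
Let sb := sh_b S. Let sa := sh_a S. Let qc := sh_q S.

Lemma dstep1_shape_mx i j : i < n -> j < n -> dstep1 A i j = (s i == j)%:Z.
Proof.
move=> hi hj; rewrite /dstep1 (crow_shape_mx S) (ocol_shape_mx S) (ccol_shape_mx S) entry_shape_mx //.
have := sh_c S hi; rewrite -/q.
have [->|/eqP ip] := eqVneq i p; last by rewrite row_other.
have sq : s p < q by [].
by rewrite (row_p S) -/q /=; case: ifP; lia.
Qed.

Lemma has_row (g : nat -> int) x m : (forall j, j < m -> g j = (x == j)%:Z) ->
  has (fun j => g j != 0%R) (iota 0 m) = (x < m).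
Proof.
move=> e; apply/hasP/idP => [[j]|h].
  by rewrite mem_iota add0n => hj; rewrite e //; lia.
by exists x; rewrite ?mem_iota // e // eqxx.
Qed.

Lemma dstep2_shape_mx i j : i < n -> j < n ->
  dstep2 A i j = ((if i <= p then s i else cright Dc q c (s i)) == j)%:Z.
Proof.
move=> hi hj; rewrite /dstep2 (crow_shape_mx S) (ocol_shape_mx S) (ccol_shape_mx S) -/q.
have qc' : q < c by [].
set t := [seq x <- iota q.+1 (c - q.+1) | Dc x].
have mark x : x < n -> has (fun i => dstep1 A i x != 0%R) (iota p.+1 (n - p.+1)) = Dc x.
  move=> hx; apply: eq_in_has => k; rewrite mem_iota => hk.
  rewrite dstep1_shape_mx; lia.
(* Column [q] is occupied by row [b] and column [c] is empty below row [p], so the nonzero columns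
   start with [q] and their shifted list ends with [c]. *)
have -> : [seq x <- iota q (c - q).+1 | has (fun i => dstep1 A i x != 0%R) (iota p.+1 (n - p.+1))] = q :: t.
  rewrite iota_ends //.
  rewrite -[RHS]/([:: q] ++ t) -cat1s filter_cat; congr (_ ++ _).
    rewrite /= mark; last by lia.
    have -> // : Dc q by rewrite /q -sb; apply: colmark_row; lia.
  rewrite filter_rcons mark // (_ : Dc c = false); last first.
    by apply/colmarkP => -[k [hk e]]; have := sh_c S (i := k); lia.
  by apply: eq_in_filter => x; rewrite mem_iota => hx; rewrite mark //; lia.
rewrite [behead _]/= index_mem -/t.
have mt x : (x \in rcons t c) = (q < x <= c) && ((x == c) || Dc x).
  rewrite mem_rcons inE mem_filter mem_iota /=; lia.
have [ip|ip] := leqP i p; first by rewrite /= dstep1_shape_mx.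
have Di : Dc (s i) by apply: colmark_row; lia.
have sc := sh_c S hi.
case: ifP => [hjc|hjc] /=; last first.
  rewrite dstep1_shape_mx //; rewrite /cright; case: ifP => // h.
  have [|h1 h2 h3] := @next_markP Dc c (s i); first by lia.
  by congr Posz; congr nat_of_bool; lia.
case: ifP => jt.
  have := jt; rewrite mt => /andP[hj2 mj].
  rewrite nth_index_prev_mark // dstep1_shape_mx //; last first.
    by have [|? _ _] := @prev_markP Dc q j; lia.
  have e : cleft Dc q c j = prev_mark Dc q j by rewrite /cleft hj2.
  congr Posz; congr nat_of_bool; apply/eqP/eqP => h.
    by rewrite h -e cleftK //; lia.
  by rewrite -e -h crightK //; lia.
have -> // : (cright Dc q c (s i) == j) = false.
apply/negbTE; apply: contraFN jt => /eqP e.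
move: hjc; rewrite -e mt /cright; case: ifP => h; last by lia.
by have [|h1 h2 h3] := @next_markP Dc c (s i); lia.
Qed.

Lemma dstep3_shape_mx i j : i < n -> j < n ->
  dstep3 A i j =
  if (o <= i <= p) && (j < q) then
    (((i == o) || (i < p) && (s i < q)) && (s (next_mark Dr p i) == j))%:Z
  else ((if i <= p then s i else cright Dc q c (s i)) == j)%:Z.
Proof.
move=> hi hj; rewrite /dstep3 (crow_shape_mx S) (ocol_shape_mx S) (orow_shape_mx S) -/q.
have qc' : q < c by [].
set t := [seq x <- iota o.+1 (p - o.+1) | Dr x].
have mark x : x <= p -> has (fun j => dstep2 A x j != 0%R) (iota 0 q) = (s x < q).
  by move=> hx; apply: has_row => k hk; rewrite dstep2_shape_mx ?hx //; lia.
have -> : [seq x <- iota o (p - o).+1 | has (fun j => dstep2 A x j != 0%R) (iota 0 q)] = rcons t p.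
  rewrite iota_ends //.
  rewrite /= mark; last by lia.
  rewrite ltnn filter_rcons mark // sa; congr rcons.
  by apply: eq_in_filter => x; rewrite mem_iota => hx; rewrite mark //; lia.
rewrite size_rcons [_.-1]/= -cats1 take_size_cat // cats1 index_mem.
have mt x : (x \in o :: t) = (x == o) || (o < x < p) && (s x < q).
  rewrite inE mem_filter mem_iota /Dr -/q; lia.
case: ifP => h; last by rewrite dstep2_shape_mx.
have -> : (i == o) || (i < p) && (s i < q) = (i \in o :: t).
  rewrite mt; have : s o = q by []; have [->//|] := eqVneq i o; lia.
case: ifP => // it; rewrite nth_index_next_mark //.
have [|h1 h2 h3] := @next_markP Dr p i.
  by move: it; rewrite mt; lia.
by rewrite dstep2_shape_mx; [rewrite (_ : next_mark Dr p i <= p) //; lia|lia|].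
Qed.

Lemma delta_shape_mx : delta A = fun_mx n (fwd n s o p c).
Proof.
apply: matrix_entryP => i j hi hj; rewrite entry_fun_mx // entry_matrix //.
rewrite /dstep4 (crow_shape_mx S) (ocol_shape_mx S) (orow_shape_mx S) -/q.
have nxq k : o <= k < p -> s (next_mark Dr p k) < q.
  move=> hk; have [|h1 h2 h3] := @next_markP Dr p k; first by lia.
  by case/orP: h2 => [/eqP ->|].
have so : s o = q by [].
have [io|oi] := leqP i o.
  rewrite fwd_top //= andbF; case: (i =P o) => [e|ne].
    rewrite e so; case: ifP => h; first by lia.
    by rewrite dstep3_shape_mx ?leqnn; [rewrite ifF ?ifT ?so //; lia|lia|].
  rewrite ifF; last by lia.
  by rewrite dstep3_shape_mx // ifF ?ifT //; lia.
have [ip|pi] := leqP i p; last first.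
  rewrite (fwd_bot S) // !andbF /= dstep3_shape_mx //.
  rewrite ifF; last by lia.
  by rewrite ifF; last by lia.
rewrite (fwd_mid S) /rin ?oi // -/Dr.
have iE : (i.-1 == o) = (i == o.+1) by lia.
have sq : i.-1 <> o -> s i.-1 <> q by move=> ne; apply: (mid_neq_q S); lia.
have siq := @mid_neq_q _ _ _ _ _ _ S i.
have nxi := nxq i.-1.
rewrite !dstep3_shape_mx; try lia.
have Drq x : Dr x = (s x < q) by [].
have -> : (i == o) = false by lia.
rewrite ?(ltnW oi) /=.
have -> : i.-1 < p by lia.
have -> : (o <= i.-1 <= p) by lia.
have -> : i.-1 <= p by lia.
rewrite iE so.
have {}nxi : s (next_mark Dr p i.-1) < q by apply: nxi; lia.
have {}siq : s i <> q by apply: siq; lia.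
(* Left side, right side, and the opening column, which the lowering leaves alone and in which no
   row from [o+1] to [p] has a 1. *)
have [jq|jq|jq] /= := ltngtP j q.
- case: (i =P o.+1) => [//|ne] /=.
  by case: (ltnP (s i.-1) q) => //= h; lia.
- case: (i =P o.+1) => [e|ne] /=; first by lia.
  by case: (ltnP (s i.-1) q) => //= h; lia.
- rewrite jq ip /=; case: (i =P o.+1) => [e|ne] /=; first by lia.
  by case: (ltnP (s i.-1) q) => //= h; lia.
Qed.

Lemma cval_shape_mx_fwd : (cval A + 1 = (\sum_(p.+1 <= k < n) (q < fwd n s o p c k <= c))%:Z)%R.
Proof. by rewrite (cval_shape_mx S) -/q -(cval_fwd S) -/q; lia. Qed.

Lemma charged_shape_mx_fwd : charged_sum A = (\sum_(o.+1 <= k < p.+1) (q < fwd n s o p c k))%:Z.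
Proof. by rewrite (charged_shape_mx S) -(charged_fwd S). Qed.

Lemma Epn_shape_mx : ~~ negative A -> Epn A = charged_sum A.
Proof.
rewrite /Epn => nn; have := sign_shape_mx S; rewrite -/A (negbTE nn) orbF.
case: ifP => //= np; rewrite (neutral_shape_mx S) => /eqP e.
by rewrite /charged_sum (orow_shape_mx S) (crow_shape_mx S) big_geq //; lia.
Qed.

End Delta.

(** * Inversions and reflection *)

Lemma sum_ord_pick n (g : nat -> int) x : x < n ->
  (\sum_(j < n) (x == j)%:Z * g j = g x)%R.
Proof.
move=> xn; rewrite (bigD1 (Ordinal xn)) //= eqxx mul1r big1 ?addr0 // => j.
by rewrite -val_eqE /= eq_sym => /negbTE ->; rewrite mul0r.
Qed.

Lemma sum_cell n s p q c i (g : nat -> int) : s i < n -> c < n -> q < n ->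
  (\sum_(j < n) cell s p q c i j * g j =
   g (s i) + if i == p then g c - g q else 0)%R.
Proof.
move=> si cn qn; rewrite /cell.
under eq_bigr do rewrite mulrDl.
rewrite big_split /= sum_ord_pick //; congr (_ + _)%R.
case: eqP => _; last by rewrite big1 // => j _; rewrite mul0r.
under eq_bigr => j _ do rewrite mulrBl (eq_sym (j : nat) c) (eq_sym (j : nat) q).
by rewrite big_split /= sumrN !sum_ord_pick.
Qed.

Lemma ninv_cell n s p q c : (forall i, i < n -> s i < n) -> c < n -> q < n ->
  let G i x := (\sum_(k < n | (i < k)%N)
     ((s k < x)%N%:Z + if k == p :> nat then (c < x)%N%:Z - (q < x)%N%:Z else 0))%R in
  ninv (\matrix_(i < n, j < n) cell s p q c i j) =
  (\sum_(i < n) (G i (s i) + if i == p :> nat then G i c - G i q else 0))%R.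
Proof.
move=> sn cn qn G; rewrite /ninv; apply: eq_bigr => i _.
rewrite -(@sum_cell n s p q c i (G i)) ?sn //; apply: eq_bigr => j _.
rewrite mxE /G mulr_sumr; apply: eq_bigr => k _.
rewrite -mulr_sumr; congr (_ * _)%R.
rewrite -(@sum_cell n s p q c k (fun l => (l < j)%N%:Z)) ?sn // big_mkcond /=.
by apply: eq_bigr => l _; rewrite mxE; case: ifP; rewrite ?mulr1 ?mulr0.
Qed.

Lemma Posz_sum (I : Type) (r : seq I) (P : pred I) (F : I -> nat) :
  (\sum_(i <- r | P i) F i)%N%:Z = (\sum_(i <- r | P i) (F i)%:Z)%R.
Proof. exact: (big_morph Posz PoszD (erefl _)). Qed.

Lemma linv_ord n s :
  (linv (index_iota 0 n) s)%:Z = (\sum_(i < n) \sum_(k < n | (i < k)%N) (s k < s i)%N%:Z)%R.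
Proof.
rewrite /linv Posz_sum big_mkord; apply: eq_bigr => i _.
rewrite Posz_sum big_mkord [RHS]big_mkcond /=; apply: eq_bigr => k _.
by case: (i < k).
Qed.

Lemma ninv_fun_mx n f : (forall i, i < n -> f i < n) ->
  ninv (fun_mx n f) = (linv (index_iota 0 n) f)%:Z.
Proof.
case: n => [|n] fn.
  by rewrite /ninv /linv big_ord0 big_nil.
(* A closing row outside the matrix turns the correction terms of [cell] off. *)
have -> : fun_mx n.+1 f = (\matrix_(i < n.+1, j < n.+1) cell f n.+1 0 0 i j)%R.
  by apply/matrixP => i j; rewrite !mxE /cell (ltn_eqF (ltn_ord i)) addr0.
rewrite ninv_cell // linv_ord; apply: eq_bigr => i _.
rewrite (ltn_eqF (ltn_ord i)) addr0; apply: eq_bigr => k _.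
by rewrite (ltn_eqF (ltn_ord k)) addr0.
Qed.

Section Ninv.
Variables (n : nat) (s : nat -> nat) (o p b c : nat).
Hypothesis S : shape n s o p b c.
Let q := s o.
Let A := shape_mx n s o p c.
Let op := sh_op S. Let pb := sh_pb S. Let bn := sh_bn S. Let cn := sh_cn S.
Let sb := sh_b S. Let sa := sh_a S. Let qc := sh_q S.

(** The closing 1 and the -1 of row [p] pair with the rows above through [q < s i < c], negatively,
    and with the rows below through [q <= s k < c]. The first count cancels against the one in
    [linv_fwd]. *)
Lemma ninv_shape_mx :
  ninv A = ((linv (index_iota 0 n) s)%:Z - (\sum_(0 <= i < p.+1) (q < s i < c))%N%:Z
            + (\sum_(p.+1 <= k < n) (q <= s k < c))%N%:Z)%R.
Proof.
have qn : q < n by lia.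
have pn : p < n by lia.
have qc' : q < c by [].
rewrite /A /shape_mx ninv_cell //; last exact: (sh_lt S).
rewrite big_split /= linv_ord; congr (_ + _)%R; last first.
  rewrite -big_mkcond /= (big_pred1 (Ordinal pn)) => [|i]; last by rewrite /= -val_eqE.
  rewrite -sumrB /= Posz_sum (big_nat_widenl _ 0) // big_mkord.
  apply: eq_bigr => k pk.
  have -> : (k == p :> nat) = false by lia.
  by rewrite !addr0; have := sh_c S (ltn_ord k); rewrite -/q; lia.
under eq_bigr do rewrite big_split /=.
rewrite big_split /=; congr (_ + _)%R.
rewrite Posz_sum (big_nat_widen _ _ n) // big_mkord -sumrN [RHS]big_mkcond /=.
apply: eq_bigr => i _; rewrite ltnS.
rewrite big_mkcond /= (bigD1 (Ordinal pn)) //= eqxx big1 ?addr0; last first.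
  by move=> k; rewrite -val_eqE /= => /negbTE ->; rewrite if_same.
have := sh_c S (ltn_ord i); rewrite -/q => ic.
case: (ltngtP i p) => ip /=; [lia|by []|].
have sq : s i < q by rewrite ip.
lia.
Qed.

(** Admitting equality with [q] adds row [b] alone. *)
Lemma sum_cval_succ :
  ((\sum_(p.+1 <= k < n) (q <= s k < c))%N%:Z = cval A + 1)%R.
Proof.
have qc' : q < c by [].
rewrite (cval_shape_mx S) -/q.
have -> : \sum_(p.+1 <= k < n) (q <= s k < c) =
          \sum_(p.+1 <= k < n) ((q < s k < c) + (k == b)).
  apply: eq_big_nat => k hk; have h := sh_eq_o S (i := k).
  have : s b = q by [].
  have [->|] := eqVneq k b; rewrite -/q in h; lia.
rewrite big_split /= sum_nat_seq_eq ?iota_uniq // mem_index_iota pb bn; lia.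
Qed.

Lemma ninv_delta : ~~ negative A -> (ninv A = ninv (delta A) + cval A + Epn A + 1)%R.
Proof.
move=> nn; rewrite (delta_shape_mx S) ninv_fun_mx; last exact: (ps_lt (fwd_pshape S)).
rewrite ninv_shape_mx sum_cval_succ (linv_fwd S) -/q (Epn_shape_mx S) // (charged_shape_mx_fwd S).
rewrite (sum_mid S (fun x => q < x)); lia.
Qed.

(* Reflection exchanges the two 1's of row [p]. *)
Definition bar_s i := if i == p then n.-1 - c else n.-1 - s i.

Lemma bar_shape : shape n bar_s o p b (n.-1 - s p).
Proof.
have bp : (b == p) = false by lia.
have op' : (o == p) = false by lia.
have qc' : s o < c by [].
split; rewrite ?/bar_s ?eqxx ?bp ?op' ?sb //; try lia.
- by move=> i hi; have := sh_lt S hi; case: ifP; lia.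
- move=> i k ik kn; have hk := sh_lt S kn.
  have hi := sh_lt S (ltn_trans ik kn).
  have ci := sh_c S (ltn_trans ik kn); have ck := sh_c S kn.
  have inj := @sh_inj _ _ _ _ _ _ S i k.
  by case: ifP => ip; case: ifP => kp; lia.
- move=> i hi; have h := sh_lt S hi.
  have ip1 := @sh_inj _ _ _ _ _ _ S i p; have ip2 := @sh_inj _ _ _ _ _ _ S p i.
  by case: ifP => ip; lia.
Qed.

Lemma bar_shape_mx : asm_bar A = shape_mx n bar_s o p (n.-1 - s p).
Proof.
apply/matrixP => i j; rewrite !mxE /= /cell /bar_s.
have op' : (o == p) = false by lia.
have si := sh_lt S (ltn_ord i); have sp := @sh_lt _ _ _ _ _ _ S p.
have hj := ltn_ord j; have qn := @sh_lt _ _ _ _ _ _ S o.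
rewrite op'; case: ((i : nat) =P p) => [e|_]; last by rewrite !addr0; lia.
have flip x : x < n -> (n - j.+1 == x) = (j == n.-1 - x :> nat) by lia.
rewrite e (eq_sym (s p)) (eq_sym _ (j : nat)) !flip //; lia.
Qed.

(** For two rows the products of entries over all pairs of columns sum to 1, because row sums are 1.
    The pairs split into inversions of the matrix, inversions of its reflection, and pairs in one
    column; the last kind contributes -1 in all, from column [q]. *)
Lemma ninv_bar : (ninv A + ninv (asm_bar A) =
  \sum_(i < n) \sum_(k < n | (i < k)%N) 1 + 1)%R.
Proof.
have qn : q < n by lia.
have pn : p < n by lia.
have sn i := @sh_lt _ _ _ _ _ _ S i.
pose X (i j k l : 'I_n) := (A i j * A k l)%R.
have -> : ninv (asm_bar A) = (\sum_(i < n) \sum_(j < n) \sum_(k < n | (i < k)%N)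
   \sum_(l < n | (j < l)%N) X i j k l)%R.
  rewrite /ninv; apply: eq_bigr => i _.
  rewrite (reindex_inj rev_ord_inj) /=; apply: eq_bigr => j _; apply: eq_bigr => k _.
  rewrite (reindex_inj rev_ord_inj) /=; apply: eq_big => l.
    by have := ltn_ord j; have := ltn_ord l; lia.
  have barE x y : asm_bar A x y = A x (rev_ord y) by rewrite [LHS]mxE.
  by move=> _; rewrite !barE !rev_ordK.
have rowsum (i : 'I_n) : (\sum_(j < n) A i j = 1)%R.
  have := @sum_cell n s p q c i (fun=> 1%R) (sn _ (ltn_ord i)) cn qn.
  rewrite subrr if_same addr0 => <-; apply: eq_bigr => j _.
  by rewrite mxE mulr1.
pose Q := (\sum_(i < n) \sum_(k < n | (i < k)%N) \sum_(j < n) X i j k j)%R.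
have tot : (ninv A + (\sum_(i < n) \sum_(j < n) \sum_(k < n | (i < k)%N)
   \sum_(l < n | (j < l)%N) X i j k l) + Q = \sum_(i < n) \sum_(k < n | (i < k)%N) 1)%R.
  rewrite /ninv /Q -!big_split /=; apply: eq_bigr => i _.
  rewrite [X in (_ + X)%R]exchange_big /= -!big_split /=.
  under eq_bigr do rewrite -!big_split /=.
  rewrite exchange_big /=; apply: eq_bigr => k _.
  transitivity (\sum_(j < n) \sum_(l < n) X i j k l)%R.
    apply: eq_bigr => j _; rewrite [RHS](bigID (fun l : 'I_n => l < j)) /= -addrA.
    congr (_ + _)%R; rewrite [RHS](bigD1 j) ?ltnn //= addrC; congr (_ + _)%R.
    by apply: eq_bigl => l; rewrite -val_eqE /=; lia.
  under eq_bigr do rewrite -mulr_sumr rowsum mulr1.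
  exact: rowsum.
suff QE : Q = (-1)%R by move: tot; rewrite QE; lia.
pose T i x := (\sum_(k < n | (i < k)%N) cell s p q c k x)%R.
have -> : Q = (\sum_(i < n) (T i (s i) + if i == p :> nat then T i c - T i q else 0))%R.
  apply: eq_bigr => i _; rewrite exchange_big /=.
  rewrite -(@sum_cell n s p q c i (T i)) ?(sn i) //; apply: eq_bigr => j _.
  by rewrite /T mulr_sumr; apply: eq_bigr => k _; rewrite /X !mxE.
have T0 i x i0 : (forall k, k < n -> cell s p q c k x = (k == i0)%:Z) -> i0 <= i -> T i x = 0%R.
  move=> e h; rewrite /T big1 // => k ik; rewrite e // (_ : _ == _ = false) //; lia.
(* Below row [o] the entries -1 and 1 of column [q] cancel; below any other row [i], column [s i]
   sums to 0 as well. Only the correction at row [p] survives, through the 1 of row [b]. *)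
have Ts i : i < n -> T i (s i) = 0%R.
  move=> hi; have [e|/eqP nq] := eqVneq (s i) q.
    rewrite e; have [io|ib] := sh_eq_o S hi e; last first.
      rewrite /T big1 // => k ik; rewrite (column_q S) //; lia.
    rewrite /T big_mkcond /= (bigD1 (Ordinal pn)) //= (bigD1 (Ordinal bn)) //=; last first.
      by rewrite -val_eqE /=; lia.
    rewrite big1; last first.
      move=> k; rewrite -!val_eqE /= => hk; case: ifP => // ik.
      rewrite (column_q S) //; lia.
    rewrite !ifT ?(column_q S) //; lia.
  have [i0 hi0 e] := column_cases S (sn i hi) nq.
  apply: (T0 _ _ i0) => //; have := e i hi; rewrite /cell eqxx.
  have := sh_c S hi; rewrite -/q; case: ifP; lia.
rewrite big_split /= big1 ?add0r => [|i _]; last exact: Ts.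
rewrite -big_mkcond /= (big_pred1 (Ordinal pn)) => [|i]; last by rewrite /= -val_eqE.
have [||i0 hi0 e] := @column_cases n s o p b c S c; [lia|rewrite -/q; lia|].
rewrite (T0 _ _ i0) //=; last first.
  have := e p pn; rewrite /cell !eqxx; have := sh_c S pn; lia.
rewrite /T big_mkcond /= (bigD1 (Ordinal bn)) //= big1; last first.
  move=> k; rewrite -!val_eqE /= => hk; case: ifP => // ik.
  rewrite (column_q S) //; lia.
rewrite pb (column_q S) //; lia.
Qed.

End Ninv.

(** * The complete discharging procedure *)

Lemma ltn_sum_nat m n (F G : nat -> nat) k : m <= k < n ->
  (forall i, m <= i < n -> F i <= G i) -> F k < G k ->
  \sum_(m <= i < n) F i < \sum_(m <= i < n) G i.
Proof.
move=> hk le lt.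
have hk' : k \in index_iota m n by rewrite mem_index_iota.
rewrite !(bigD1_seq k) ?iota_uniq //= -addSn; apply: leq_add => //.
rewrite big_seq_cond [leqRHS]big_seq_cond; apply: leq_sum => i.
by rewrite mem_index_iota => /andP[/le].
Qed.

Lemma fun_mx_inj n f g : (forall i, i < n -> f i < n) -> fun_mx n f = fun_mx n g ->
  forall i, i < n -> f i = g i.
Proof.
move=> fn e i hi; have := congr1 (fun M => entry M i (f i)) e.
rewrite !entry_fun_mx ?fn //; lia.
Qed.

Section Sign.
Variables (n : nat) (s : nat -> nat) (o p b c : nat).
Hypothesis S : shape n s o p b c.
Let q := s o.
Let A := shape_mx n s o p c.

Lemma nonneg_shape_mx : ~~ negative A = positive A || neutral A.
Proof.
rewrite (positive_shape_mx S) (neutral_shape_mx S) (negative_shape_mx S).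
have := sh_op S; have := @mid_neq_q _ _ _ _ _ _ S p.-1; lia.
Qed.

(** When the 1 of the lowest enclosed row is in the right side, lowering brings it to row [p]. The
    count defining E therefore jumps at [p], which makes [p] recoverable. *)
Lemma fwd_last : ~~ negative A -> p = o.+1 \/ q < fwd n s o p c p.
Proof.
have op := sh_op S.
rewrite nonneg_shape_mx (positive_shape_mx S) (neutral_shape_mx S) => /orP[/andP[h1 h2]|/eqP]; last by left.
right; rewrite (fwd_mid S) ?op ?leqnn // /rin ifF // -/q; lia.
Qed.

End Sign.

Lemma nonnegE n (A : 'M[int]_n) : inA1 A -> ~~ negative A = positive A || neutral A.
Proof. by move=> /inA1_shape_mx [s [o [p [b [c [S ->]]]]]]; apply: nonneg_shape_mx S. Qed.

Lemma Delta_inj n (A B : 'M[int]_n) : inA1 A -> inA1 B ->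
  ~~ negative A -> ~~ negative B -> Delta A = Delta B -> A = B.
Proof.
move=> /inA1_shape_mx [s [o [p [b [c [S ->]]]]]] /inA1_shape_mx [s' [o' [p' [b' [c' [S' ->]]]]]].
move=> nA nB; rewrite /Delta (orow_shape_mx S) (orow_shape_mx S') (Epn_shape_mx S nA) (Epn_shape_mx S' nB).
rewrite (delta_shape_mx S) (delta_shape_mx S') (charged_shape_mx_fwd S) (charged_shape_mx_fwd S').
case=> eo edelta ecval eE; subst o'.
have P := fwd_pshape S; have P' := fwd_pshape S'.
have pn := ps_pn P; have pn' := ps_pn P'.
have fE := fun_mx_inj (ps_lt P) edelta.
have op := sh_op S; have op' := sh_op S'.
have fl := fwd_last S nA; have fl' := fwd_last S' nB.
have qE : s o = s' o by have := fE o; rewrite !fwd_top //; apply; lia.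
have cE := cval_shape_mx_fwd S; have cE' := cval_shape_mx_fwd S'.
rewrite ecval cE' in cE; case: cE => {cE' ecval} cE.
rewrite -qE in fl' eE cE.
set f := fwd n s o p c in P fE fl eE cE.
set g := fwd n s' o p' c' in P' fE fl' eE cE.
have pE : p = p'.
  have step u v (h : nat -> nat) : o < u -> u < v -> s o < h v ->
     \sum_(o.+1 <= k < u.+1) (s o < h k) < \sum_(o.+1 <= k < v.+1) (s o < h k).
    move=> ou uv hv; rewrite [X in _ < X](@big_cat_nat _ _ _ u.+1) //=; try lia.
    by rewrite (@big_nat_recr _ _ _ v u.+1) //= hv; lia.
  have eq2 u : u < n -> \sum_(o.+1 <= k < u.+1) (s o < f k) = \sum_(o.+1 <= k < u.+1) (s o < g k).
    by move=> un; apply: eq_big_nat => k hk; rewrite fE //; lia.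
  have [lt|lt|//] := ltngtP p p'.
    by have := step p p' g; rewrite -eq2 //; lia.
  by have := step p' p f; rewrite eq2 //; lia.
subst p'.
have ccE : c = c'.
  have eq2 x : \sum_(p.+1 <= k < n) (s o < f k <= x) = \sum_(p.+1 <= k < n) (s o < g k <= x).
    by apply: eq_big_nat => k hk; rewrite fE //; lia.
  have [qc qc'] := (sh_q S, sh_q S'); rewrite -qE in qc'.
  have [lt|lt|//] := ltngtP c c'.
    have [k [hk ek]] := ps_c P'.
    have := @ltn_sum_nat p.+1 n (fun k => s o < g k <= c : nat) (fun k => s o < g k <= c' : nat) k hk.
    rewrite /= -eq2 cE ltnn ek => h; exfalso.
    by have // : false; apply: h => [i _|]; lia.
  have [k [hk ek]] := ps_c P.
  have := @ltn_sum_nat p.+1 n (fun k => s o < f k <= c' : nat) (fun k => s o < f k <= c : nat) k hk.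
  rewrite /= eq2 cE ltnn ek => h; exfalso.
  by have // : false; apply: h => [i _|]; lia.
subst c'.
have sE i : i < n -> s i = s' i.
  move=> hi; rewrite -(fwdK S hi) -(fwdK S' hi).
  by apply: eq_back => //; rewrite op.
apply: matrix_entryP => i j hi hj; rewrite !entry_shape_mx // /cell qE sE //.
Qed.

(** Rows and columns are taken as least thresholds: [p] for the count [G] to reach [E], then [c] for
    the count [H] to exceed [cv]. Both counts grow by at most one at a time, so the thresholds are
    met exactly, and minimality gives the sign condition and makes [c] a value of [f] below [p]. *)
Lemma Delta_surj n f o cv E : (forall i, i < n -> f i < n) ->
  (forall i k, i < n -> k < n -> f i = f k -> i = k) ->
  o.+1 < n -> f o.+1 < f o ->
  cv + E < \sum_(o.+1 <= i < n) (f o < f i) ->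
  exists A : 'M[int]_n, [/\ inA1 A, ~~ negative A & Delta A = (o, fun_mx n f, cv%:Z, E%:Z)].
Proof.
move=> fn finj on fa tot; set q := f o in fa tot.
pose G p := \sum_(o.+1 <= i < p.+1) (q < f i).
have GS p : o < p -> G p.+1 = G p + (q < f p.+1).
  by move=> op; rewrite /G big_nat_recr //=; lia.
have Go : G o.+1 = 0 by rewrite /G big_nat1; lia.
have exp : exists p, (o < p) && (E <= G p).
  exists n.-1; rewrite /G prednK; lia.
case: (ex_minnP exp) => p /andP[op Ep] minp.
have pn : p < n.
  have := minp n.-1; rewrite {1}/G prednK; lia.
have [Gp lastp] : G p = E /\ (p = o.+1 \/ q < f p).
  have [po|po] := eqVneq p o.+1; first by rewrite po in Ep *; rewrite Go; split; [lia|left].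
  have := minp p.-1; have := GS p.-1; rewrite prednK; last by lia.
  by case: (q < f p); split; try right; lia.
have rest : cv < \sum_(p.+1 <= i < n) (q < f i).
  move: tot; rewrite (@big_cat_nat _ _ _ p.+1) /=; try lia.
  by rewrite -/(G p) Gp; lia.
pose H x := \sum_(p.+1 <= i < n) (q < f i <= x).
have exc : exists x, cv < H x.
  exists n; rewrite /H; apply: leq_trans rest _.
  rewrite big_nat [leqRHS]big_nat; apply: leq_sum => i hi.
  by have := fn i; lia.
case: (ex_minnP exc) => c Hc minc.
have [k [hk ek] qc] : exists2 k, p < k < n /\ f k = c & q < c.
  have [/andP[/colmarkP [k hk] qc]|no] := boolP (colmark n f p c && (q < c)); first by exists k.
  have : H c <= H c.-1.
    rewrite /H big_nat [leqRHS]big_nat; apply: leq_sum => i hi.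
    have [e|ne] := eqVneq (f i) c; last by lia.
    have : colmark n f p c by apply/colmarkP; exists i.
    by lia.
  have H0 : H 0 = 0 by rewrite /H big1 // => i _; lia.
  have c0 : 0 < c by case: posnP Hc => // ->; rewrite H0.
  by have := minc c.-1; lia.
have Hcv : H c = cv.+1.
  have : H c = H c.-1 + \sum_(p.+1 <= i < n) (i == k).
    rewrite /H -big_split; apply: eq_big_nat => i hi /=.
    have := finj i k; have [->|] := eqVneq i k; lia.
  rewrite sum_nat_seq_eq ?iota_uniq // mem_index_iota hk.
  by have := minc c.-1; lia.
have P : pshape n f o p c by split => //; exists k.
have [b S] := back_shape P; set s := back n f o p c in S.
have so : s o = q by rewrite /s back_top.
have fK i : i < n -> fwd n s o p c i = f i by move=> hi; apply: backK P _ hi.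
have nn : ~~ negative (shape_mx n s o p c).
  rewrite (negative_shape_mx S) so; apply/negP => /andP[h].
  rewrite (back_left P) ?prednK -/q; lia.
exists (shape_mx n s o p c); split=> //; first exact: shape_mx_inA1 S.
rewrite /Delta (orow_shape_mx S) (delta_shape_mx S) (Epn_shape_mx S) // (charged_shape_mx_fwd S) so.
congr (_, _, _, _).
- by apply: matrix_entryP => i j hi hj; rewrite !entry_fun_mx // fK.
- apply: (@addIr _ 1%R); rewrite (cval_shape_mx_fwd S) so.
  have -> : \sum_(p.+1 <= i < n) (q < fwd n s o p c i <= c) = H c.
    by apply: eq_big_nat => i hi; rewrite fK //; lia.
  by rewrite Hcv; lia.
- congr Posz; rewrite -Gp; apply: eq_big_nat => i hi; rewrite fK //; lia.
Qed.

(** For a positive matrix the lowest enclosed row is itself counted by E; this is how E tells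
    positive from neutral. *)
Lemma Epn_range n (A : 'M[int]_n) : inA1 A -> ~~ negative A ->
  [/\ (0 <= cval A)%R, (0 <= Epn A)%R & positive A = (0 < Epn A)%R].
Proof.
move=> /inA1_shape_mx [s [o [p [b [c [S ->]]]]]] nn.
rewrite (cval_shape_mx S) (Epn_shape_mx S) // (charged_shape_mx S); split=> //.
have := nn; rewrite (nonneg_shape_mx S) (positive_shape_mx S) (neutral_shape_mx S).
have op := sh_op S; case: ltnP => h /=; last first.
  by rewrite big_geq.
rewrite (ltn_eqF h) orbF => h2; rewrite h2.
have -> : p = p.-1.+1 by lia.
by rewrite big_nat_recr /= ?h2; lia.
Qed.

(** The condition in [Delta_surj] involves only the total of [cv] and [E], so every other splitting
    of the total realized by [A] is realized too. [E = 0] yields the neutral partner, and the other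
    values invert [Lambda]. *)
Lemma Delta_lift n (A : 'M[int]_n) (E : int) : inA1 A -> ~~ negative A ->
  (0 <= E <= cval A + Epn A)%R ->
  exists B : 'M[int]_n, [/\ inA1 B, ~~ negative B &
    Delta B = (orow A, delta A, (cval A + Epn A - E)%R, E)].
Proof.
move=> /inA1_shape_mx [s [o [p [b [c [S ->]]]]]] nn.
have := cval_shape_mx_fwd S; have := Epn_shape_mx S nn; rewrite (charged_shape_mx_fwd S) => -> e1 hE.
rewrite (orow_shape_mx S) (delta_shape_mx S).
have P := fwd_pshape S; set f := fwd n s o p c in P e1 hE *.
have fo : f o = s o by rewrite /f fwd_top.
have pn := ps_pn P; have op := ps_op P.
set X := (\sum_(o.+1 <= k < p.+1) _)%N in hE *.
set Y := (\sum_(p.+1 <= k < n) _)%N in e1.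
have tot : X + Y <= \sum_(o.+1 <= i < n) (f o < f i).
  rewrite (@big_cat_nat _ _ _ p.+1) /=; try lia.
  rewrite fo leq_add2l /Y; rewrite big_nat [leqRHS]big_nat; apply: leq_sum => i hi; lia.
have [||B [h1 h2 h3]] := @Delta_surj n f o (absz (cval (shape_mx n s o p c) + X%:Z - E)%R) (absz E)
  (ps_lt P) (ps_inj P) _ (ps_a P); try lia.
exists B; split => //; rewrite h3; congr (_, _, _, _); lia.
Qed.

Lemma ell_Delta n (A B : 'M[int]_n) : inA1 A -> inA1 B ->
  orow A = orow B -> delta A = delta B -> ell A = ell B.
Proof.
move=> /inA1_shape_mx [s [o [p [b [c [S ->]]]]]] /inA1_shape_mx [s' [o' [p' [b' [c' [S' ->]]]]]].
rewrite (orow_shape_mx S) (orow_shape_mx S') (delta_shape_mx S) (delta_shape_mx S') => eo; subst o'.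
have P := fwd_pshape S => /(fun_mx_inj (ps_lt P)) fE.
have := ps_op P; have := ps_pn P => pn op.
rewrite (ell_shape_mx S) (ell_shape_mx S') /=; congr Posz; apply: eq_big_nat => i hi.
by rewrite !fE //; lia.
Qed.

Lemma rows_Delta n (A B : 'M[int]_n) : inA1 A -> inA1 B ->
  orow A = orow B -> delta A = delta B ->
  forall i j, i <= orow A -> j < n -> entry A i j = entry B i j.
Proof.
move=> /inA1_shape_mx [s [o [p [b [c [S ->]]]]]] /inA1_shape_mx [s' [o' [p' [b' [c' [S' ->]]]]]].
rewrite (orow_shape_mx S) (orow_shape_mx S') (delta_shape_mx S) (delta_shape_mx S') => eo; subst o'.
have P := fwd_pshape S => /(fun_mx_inj (ps_lt P)) fE i j io jn.
have := ps_op P; have := ps_pn P => pn op; have := sh_op S' => op'.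
have := fE i; rewrite !fwd_top // => e.
rewrite !entry_shape_mx //; try lia.
by rewrite !row_other ?e //; lia.
Qed.

Lemma ninv_Delta n (A : 'M[int]_n) : inA1 A -> ~~ negative A ->
  (ninv A = ninv (delta A) + cval A + Epn A + 1)%R.
Proof. by move=> /inA1_shape_mx [s [o [p [b [c [S ->]]]]]]; apply: ninv_delta S. Qed.

(** * Effect of reflection on signs and parameters *)

Section Bar.
Variables (n : nat).
Implicit Type A : 'M[int]_n.

Lemma asm_barK A : asm_bar (asm_bar A) = A.
Proof. by apply/matrixP => i j; rewrite !mxE rev_ordK. Qed.

Lemma bar_inA1 A : inA1 A -> inA1 (asm_bar A).
Proof.
move=> /inA1_shape_mx [s [o [p [b [c [S ->]]]]]]; rewrite (bar_shape_mx S).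
exact: shape_mx_inA1 (bar_shape S).
Qed.

Lemma bar_orow A : inA1 A -> orow (asm_bar A) = orow A.
Proof.
move=> /inA1_shape_mx [s [o [p [b [c [S ->]]]]]]; rewrite (bar_shape_mx S).
by rewrite (orow_shape_mx S) (orow_shape_mx (bar_shape S)).
Qed.

Lemma bar_neutral A : inA1 A -> neutral (asm_bar A) = neutral A.
Proof.
move=> /inA1_shape_mx [s [o [p [b [c [S ->]]]]]]; rewrite (bar_shape_mx S).
by rewrite (neutral_shape_mx S) (neutral_shape_mx (bar_shape S)).
Qed.

Lemma bar_negative A : inA1 A -> negative (asm_bar A) = positive A.
Proof.
move=> /inA1_shape_mx [s [o [p [b [c [S ->]]]]]]; rewrite (bar_shape_mx S).
rewrite (positive_shape_mx S) (negative_shape_mx (bar_shape S)) /bar_s.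
have op := sh_op S; have pb := sh_pb S; have bn := sh_bn S.
rewrite !ifF; try lia.
have := @sh_lt _ _ _ _ _ _ S o; have := @sh_lt _ _ _ _ _ _ S p.-1; lia.
Qed.

Lemma bar_positive A : inA1 A -> positive (asm_bar A) = negative A.
Proof. by move=> hA; rewrite -bar_negative ?asm_barK //; apply: bar_inA1. Qed.

Lemma neutral_nonneg A : neutral A -> ~~ negative A.
Proof. by rewrite /neutral /negative => /eqP ->; rewrite ltnn. Qed.

Lemma neutral_nonpos A : neutral A -> ~~ positive A.
Proof. by rewrite /neutral /positive => /eqP ->; rewrite ltnn. Qed.

(** With no enclosed rows the leading 1 is the left 1 of row [p], and reflection turns its column
    into the closing column. *)
Lemma cval_bar A : inA1 A -> neutral A -> cval (asm_bar A) = ell A.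
Proof.
move=> /inA1_shape_mx [s [o [p [b [c [S ->]]]]]]; rewrite (bar_shape_mx S) (neutral_shape_mx S) => /eqP op.
rewrite (cval_shape_mx (bar_shape S)) (ell_shape_mx S) /=; congr Posz.
have -> : fwd n s o p c o = s o by rewrite fwd_top.
rewrite -(ell_fwd S).
have pb := sh_pb S; have bn := sh_bn S; have oq := sh_op S.
have -> : fwd n s o p c o.+1 = s p.
  rewrite (fwd_mid S) ?oq ?leqnn // /rin eqxx /=; congr (s _).
  by have [|h1 h2 h3] := @next_markP (fun x => s x < s o) p o; lia.
rewrite [RHS]big_ltn; last by lia.
have -> : (s p < s o.+1 < s o) = false by rewrite op ltnn.
rewrite add0n op; apply: eq_big_nat => i hi.
rewrite /bar_s !ifF; try lia.
have := @sh_lt _ _ _ _ _ _ S o; have := @sh_lt _ _ _ _ _ _ S p.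
have := @sh_lt _ _ _ _ _ _ S i; lia.
Qed.

Lemma ell_bar A : inA1 A -> neutral A -> ell (asm_bar A) = cval A.
Proof.
move=> hA nA; rewrite -{2}(asm_barK A) cval_bar ?bar_neutral //.
exact: bar_inA1.
Qed.

Lemma ninv_add_bar A : inA1 A -> (ninv A + ninv (asm_bar A) =
  \sum_(i < n) \sum_(k < n | (i < k)%N) 1 + 1)%R.
Proof. by move=> /inA1_shape_mx [s [o [p [b [c [S ->]]]]]]; apply: ninv_bar S. Qed.

End Bar.

(** * The neutralizing procedure *)

Section Neutralizing.
Variable n : nat.
Implicit Types (A B N : 'M[int]_n) (E : int).

(** The choices by [pick] range over codes, so every relevant matrix must have one: its entries
    shifted by 1 lie in 0, 1, 2. *)
Lemma inA1_code A : inA1 A -> exists f, asm_of_code f = A.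
Proof.
move=> /inA1_shape_mx [s [o [p [b [c [S ->]]]]]].
pose g (ij : 'I_n * 'I_n) : 'I_3 := inord (absz (cell s p (s o) c ij.1 ij.2 + 1)%R).
exists (finfun g); apply/matrixP => i j; rewrite !mxE ffunE /g /=.
have qc := sh_q S; have ic := sh_c S (ltn_ord i); have sa := sh_a S.
have [h0 h1] : (0 <= cell s p (s o) c i j + 1)%R /\ (cell s p (s o) c i j + 1 < 3)%R.
  by rewrite /cell; case: ((i : nat) =P p) => [->|_]; lia.
rewrite inordK; lia.
Qed.

Lemma inA1_pick A (P : pred 'M[int]_n) : inA1 A -> P A ->
  exists f, P (asm_of_code f) /\ [pick f : {ffun 'I_n * 'I_n -> 'I_3} | P (asm_of_code f)] = Some f.
Proof.
move=> /inA1_code [f <-] Pf; case: pickP => [g Pg|/(_ f)]; last by rewrite Pf.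
by exists g.
Qed.

Lemma neutral_partnerP A : inA1 A -> ~~ negative A ->
  let N := neutral_partner A in
  [/\ inA1 N, neutral N & Delta N = (orow A, delta A, (cval A + Epn A)%R, 0%R)].
Proof.
move=> hA nA; have [h1 h2 _] := Epn_range hA nA.
have [|B [hB nB dB]] := @Delta_lift n A 0%R hA nA; first by lia.
rewrite subr0 in dB.
have [|f [/and3P[hf nf /eqP df] pf]] := @inA1_pick B (fun M => [&& inA1 M, positive M || neutral M &
              Delta M == (orow A, delta A, (cval A + Epn A)%R, 0%R)]) hB.
  by rewrite hB -nonnegE // nB dB eqxx.
rewrite /neutral_partner pf; split=> //.
rewrite -nonnegE // in nf; have [_ _ e] := Epn_range hf nf.
have := nf; rewrite nonnegE // e.
by case: df => _ _ _ ->; rewrite ltxx.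
Qed.

Lemma neutral_partner_unique A N : inA1 A -> ~~ negative A -> inA1 N -> ~~ negative N ->
  Delta N = (orow A, delta A, (cval A + Epn A)%R, 0%R) -> neutral_partner A = N.
Proof.
move=> hA nA hN nN dN; have [h1 h2 h3] := neutral_partnerP hA nA.
by apply: Delta_inj => //; [apply: neutral_nonneg|rewrite h3 dN].
Qed.

Lemma neutral_Epn N : neutral N -> Epn N = 0%R.
Proof. by move=> h; rewrite /Epn (negbTE (neutral_nonpos h)). Qed.

Lemma neutral_partner_id N : inA1 N -> neutral N -> neutral_partner N = N.
Proof.
move=> hN nN; have nn := neutral_nonneg nN.
by apply: neutral_partner_unique => //; rewrite neutral_Epn // addr0 /Delta neutral_Epn.
Qed.

(** For the two charged signs this unfolds the definition. A neutral matrix is its own partner with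
    E = 0, and so is its reflection. *)
Lemma Lambda_bar A : inA1 A ->
  Lambda (asm_bar A) = (asm_bar (Lambda A).1, (- (Lambda A).2)%R).
Proof.
move=> hA; have hB := bar_inA1 hA.
rewrite /Lambda bar_negative // asm_barK; have [pA|pA] := boolP (positive A).
  by rewrite ifF //; apply/negbTE; rewrite nonnegE // pA.
have [nA|nA] := boolP (negative A); first by rewrite /= asm_barK opprK.
have neA : neutral A by move: nA; rewrite nonnegE // (negbTE pA).
rewrite /LambdaPN !neutral_partner_id ?bar_neutral //=.
by rewrite !neutral_Epn ?bar_neutral // oppr0.
Qed.

Lemma Lambda_nonneg A : ~~ negative A -> Lambda A = LambdaPN A.
Proof. by rewrite /Lambda => /negbTE ->. Qed.

(** What the pair [(N, E)] remembers of [A]. Since [xi] fixes [N] and exchanges [E] with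
    [cval N - ell N - E], these fields give the exchange of E and B and the invariance of the
    rest. *)
Record neutralized A N E : Prop := Neutralized {
  nt_in : inA1 N; nt_neutral : neutral N;
  nt_E : Eprm A = E;
  nt_neg : negative A = (E < 0)%R;
  nt_lo : (- ell N <= E)%R; nt_hi : (E <= cval N)%R;
  nt_B : Bprm A = (cval N - ell N - E)%R;
  nt_J : Jprm A = (cval N + ell N + 1)%R;
  nt_orow : orow N = orow A;
  nt_rows : forall i j, i <= orow A -> j < n -> entry N i j = entry A i j;
  nt_ninv : ninv N = ninv A }.

Lemma ell_ge0 A : inA1 A -> (0 <= ell A)%R.
Proof. by move=> /inA1_shape_mx [s [o [p [b [c [S ->]]]]]]; rewrite (ell_shape_mx S). Qed.

(** Everything follows from c(N) = c(A) + E, l(N) = l(A) and the common discharged matrix; the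
    inversion number sees c and E only through their sum. *)
Lemma LambdaPN_neutralized A : inA1 A -> ~~ negative A ->
  neutralized A (LambdaPN A).1 (LambdaPN A).2.
Proof.
move=> hA nA; rewrite /LambdaPN /=; have [hN neN dN] := neutral_partnerP hA nA.
set N := neutral_partner A in hN neN dN *.
have nN := neutral_nonneg neN.
have nnN := ninv_Delta hN nN; have nnA := ninv_Delta hA nA.
case: dN => e1 e2 e3 e4.
have eE := ell_Delta hN hA e1 e2; have [c0 E0 _] := Epn_range hA nA.
have l0 := ell_ge0 hA.
split=> //; rewrite ?/Eprm ?/Bprm ?/Jprm ?(negbTE nA) //.
- by rewrite ltNge E0.
- by rewrite eE; lia.
- by rewrite e3; lia.
- by rewrite /Bpn e3 eE; lia.
- by rewrite /Jpn e3 eE ger0_norm //; lia.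
- by rewrite -e1; apply: rows_Delta.
- by rewrite nnN nnA e2 e3 e4; lia.
Qed.

Lemma entry_bar A i j : i < n -> j < n -> entry (asm_bar A) i j = entry A i (n - j.+1).
Proof.
move=> hi hj; rewrite -[i]/(val (Ordinal hi)) -[j in LHS]/(val (Ordinal hj)).
rewrite -[n - _]/(val (rev_ord (Ordinal hj))) !entry_ord mxE //.
Qed.

Lemma orow_lt A : inA1 A -> orow A < n.
Proof.
move=> /inA1_shape_mx [s [o [p [b [c [S ->]]]]]]; rewrite (orow_shape_mx S).
by have := sh_op S; have := sh_pb S; have := sh_bn S; lia.
Qed.

Lemma Lambda_neutralized A : inA1 A -> neutralized A (Lambda A).1 (Lambda A).2.
Proof.
move=> hA; have [nA|nA] := boolP (negative A); last first.
  by rewrite Lambda_nonneg //; apply: LambdaPN_neutralized.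
have hB := bar_inA1 hA.
have pB : positive (asm_bar A) by rewrite bar_positive.
have nB : ~~ negative (asm_bar A) by rewrite nonnegE // pB.
have := LambdaPN_neutralized hB nB; rewrite /Lambda nA.
case: (LambdaPN _) => M E /= [hM neM eE eneg lo hi eB eJ eo rows einv].
have [_ _ ep] := Epn_range hB nB; rewrite pB in ep.
have on := orow_lt hA.
move: eE eB eJ; rewrite /Eprm /Bprm /Jprm (negbTE nB) => eE eB eJ.
split; rewrite ?/Eprm ?/Bprm ?/Jprm ?nA ?cval_bar ?ell_bar ?bar_neutral ?bar_orow //.
- exact: bar_inA1.
- by rewrite eE.
- by rewrite -eE; lia.
- by lia.
- by lia.
- by rewrite eB; lia.
- by rewrite eJ; lia.
- by rewrite eo bar_orow.
- move=> i j io jn; rewrite entry_bar ?rows ?bar_orow //; try lia.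
  by rewrite entry_bar; try lia; congr (entry A _ _); lia.
(* Reflection complements the inversion number to the same constant for both matrices, so equality
   for the reflections carries over. *)
- by have := ninv_add_bar hM; have := ninv_add_bar hA; rewrite einv; lia.
Qed.

(** The sign of E tells whether a matrix is negative; reflection reduces the negative case to the
    other, where [N] and [E] together restore [Delta]. *)
Lemma Lambda_inj A B : inA1 A -> inA1 B -> Lambda A = Lambda B -> A = B.
Proof.
have PN (M M' : 'M[int]_n) : inA1 M -> inA1 M' -> ~~ negative M -> ~~ negative M' ->
    LambdaPN M = LambdaPN M' -> M = M'.
  move=> hM hM' nM nM'; rewrite /LambdaPN => -[eN eE].
  have [_ _ d] := neutral_partnerP hM nM; have [_ _ d'] := neutral_partnerP hM' nM'.
  rewrite eN d' in d; case: d => e1 e2 e3.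
  apply: Delta_inj => //; rewrite /Delta e1 e2 eE; congr (_, _, _, _).
  by move: e3; rewrite eE; lia.
move=> hA hB e.
have [nA nB] := (nt_neg (Lambda_neutralized hA), nt_neg (Lambda_neutralized hB)).
rewrite e -nB in nA; have [nn|nn] := boolP (negative A); last first.
  have nn' : ~~ negative B by rewrite -nA.
  by apply: PN => //; rewrite -!Lambda_nonneg.
have pn (M : 'M[int]_n) : inA1 M -> negative M -> ~~ negative (asm_bar M).
  by move=> hM nM; rewrite nonnegE ?bar_positive ?nM //; apply: bar_inA1.
rewrite -[A]asm_barK -[B]asm_barK; congr asm_bar.
have nn' : negative B by rewrite -nA.
apply: PN; rewrite ?bar_inA1 ?pn //.
by rewrite -!Lambda_nonneg ?pn // !Lambda_bar // e.
Qed.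

(** For [E >= 0] the total [cval N] is split as [cval N - E] and [E], and [N] is the partner of the
    result. For [E < 0] the same is done to the reflection, whose [cval] is [ell N]. *)
Lemma Lambda_surj N E : inA1 N -> neutral N -> (- ell N <= E <= cval N)%R ->
  exists2 A, inA1 A & Lambda A = (N, E).
Proof.
have PN (M : 'M[int]_n) (F : int) : inA1 M -> neutral M -> (0 <= F <= cval M)%R ->
    exists B, [/\ inA1 B, ~~ negative B & Lambda B = (M, F)].
  move=> hM neM hF; have nM := neutral_nonneg neM.
  have [|B [hB nB dB]] := @Delta_lift n M F hM nM.
    by rewrite neutral_Epn // addr0.
  exists B; split=> //; rewrite Lambda_nonneg //.
  case: dB => e1 e2 e3 e4; rewrite neutral_Epn // in e3.
  rewrite /LambdaPN e4; congr (_, _); apply: neutral_partner_unique => //.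
  rewrite /Delta e1 e2 e3 e4 neutral_Epn //; congr (_, _, _, _); lia.
move=> hN neN /andP[lo hi]; have [h0|h0] := leP 0%R E.
  by have [|B [hB _ e]] := PN N E hN neN; [lia|exists B].
have [||| B [hB _ e]] := PN (asm_bar N) (- E)%R.
- exact: bar_inA1.
- by rewrite bar_neutral.
- by rewrite cval_bar //; lia.
exists (asm_bar B); first exact: bar_inA1.
by rewrite Lambda_bar // e /= asm_barK opprK.
Qed.

Lemma Lambda_invP N E : inA1 N -> neutral N -> (- ell N <= E <= cval N)%R ->
  inA1 (Lambda_inv (N, E)) /\ Lambda (Lambda_inv (N, E)) = (N, E).
Proof.
move=> hN neN hE; have [A hA e] := Lambda_surj hN neN hE.
have [|f [/andP[hf /eqP lf] pf]] := @inA1_pick A (fun M => inA1 M && (Lambda M == (N, E))) hA.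
  by rewrite hA e eqxx.
by rewrite /Lambda_inv pf.
Qed.

Lemma asm_primeP A : inA1 A ->
  inA1 (asm_prime A) /\ Lambda (asm_prime A) = xi (Lambda A).
Proof.
move=> hA; have L := Lambda_neutralized hA; have := nt_lo L; have := nt_hi L => hi lo.
rewrite /asm_prime /xi; apply: Lambda_invP; [exact: nt_in L|exact: nt_neutral L|].
by lia.
Qed.

(** Reflection swaps [cval] and [ell] on neutral matrices, which changes the sign of
    [cval N - ell N]. *)
Lemma xi_bar N E : inA1 N -> neutral N ->
  xi (asm_bar N, (- E)%R) = (asm_bar (xi (N, E)).1, (- (xi (N, E)).2)%R).
Proof. by move=> hN neN; rewrite /xi /= cval_bar // ell_bar //; congr (_, _); lia. Qed.

End Neutralizing.

(** * The involution and its properties *)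

Theorem theorem2 (n : nat) (A : 'M[int]_n) :
  inA1 A ->
  [/\ inA1 (asm_prime A) /\ asm_prime (asm_prime A) = A,
      [/\ orow (asm_prime A) = orow A,
          (forall (i j : 'I_n), (i <= orow A)%N -> asm_prime A i j = A i j)
        & rnum (asm_prime A) = rnum A],
      ninv (asm_prime A) = ninv A /\ Jprm (asm_prime A) = Jprm A,
      Eprm (asm_prime A) = Bprm A /\ Bprm (asm_prime A) = Eprm A
    & asm_prime (asm_bar A) = asm_bar (asm_prime A)].
Proof.
move=> hA; have [hA' lA'] := asm_primeP hA.
have L := Lambda_neutralized hA; have := Lambda_neutralized hA'.
rewrite lA' /= => L'.
(* Both matrices have the same neutral [N], whose rows down to the opening row are theirs. *)
have rows i j : i <= orow A -> j < n -> entry (asm_prime A) i j = entry A i j.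
  move=> io jn; rewrite -(nt_rows L) // -(nt_rows L') //.
  by rewrite -(nt_orow L') (nt_orow L).
split.
(* [xi] is an involution on pairs, and [Lambda_inj] transports this to matrices. *)
- split=> //; have [hA2 lA2] := asm_primeP hA'.
  apply: Lambda_inj => //; rewrite lA2 lA' /xi /=.
  by case: (Lambda A) => N E /=; congr (_, _); lia.
- split.
  + by rewrite -(nt_orow L') (nt_orow L).
  + by move=> i j io; rewrite -!entry_ord rows.
  + rewrite /rnum /the_nat; congr nth; apply: eq_in_filter => j; rewrite mem_iota => hj.
    by rewrite rows //; lia.
- by rewrite -(nt_ninv L) -(nt_ninv L') (nt_J L) (nt_J L').
- rewrite (nt_E L') (nt_B L') (nt_E L) (nt_B L); split=> //; lia.
(* Both [Lambda] and [xi] commute with reflecting the matrix and negating E, so the two sides have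
   the same image under [Lambda]. *)
- have hb := bar_inA1 hA; have [hb' lb'] := asm_primeP hb.
  apply: Lambda_inj => //; first exact: bar_inA1.
  rewrite lb' !Lambda_bar // lA' xi_bar ?(nt_in L) ?(nt_neutral L) //.
Qed.
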